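(* Let $G$ be a connected bipartite graph on $n$ vertices. Then, for every real number $p\ge 2$, $$\mathcal E_p^+(G)\ge \mathcal E_p^+(P_n).$$
   Context: All graphs are finite, simple, undirected and unweighted. For a graph $G$ on $n$ vertices, $A(G)$ is its $n\times n$ adjacency matrix ($0$-$1$ entries), and $\lambda_1(G),\dots,\lambda_n(G)$ are the eigenvalues of $A(G)$ counted with multiplicity. For $p>0$, the positive adjacency $p$-energy is $\mathcal E_p^+(G)=\sum_{i:\lambda_i(G)>0}\lambda_i(G)^p$. $P_n$ denotes the path on $n$ vertices ($P_1$ is a single vertex). *)

(* Defs.v *)
From mathcomp Require Import all_boot all_order all_algebra.
From mathcomp Require Import polyrcf complex.
From mathcomp Require Import reals exp.

Set Implicit Arguments.
Unset Strict Implicit.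
Unset Printing Implicit Defensive.

Import Order.TTheory GRing.Theory Num.Theory.
Local Open Scope ring_scope.

Record sgraph := SGraph {
  vertex :> finType;
  edge : rel vertex;
  edge_sym : symmetric edge;
  edge_irrefl : irreflexive edge
}.

Definition connected_graph (G : sgraph) : Prop :=
  forall x y : G, connect (@edge G) x y.

Definition bipartite_graph (G : sgraph) : Prop :=
  exists side : G -> bool, forall x y : G, edge x y -> side x != side y.

Definition path_edge (n : nat) : rel 'I_n :=
  [rel i j : 'I_n | (i.+1 == j) || (j.+1 == i)].

Lemma path_edge_sym n : symmetric (@path_edge n).
Proof. by move=> i j; rewrite /path_edge /= orbC. Qed.

Lemma path_edge_irrefl n : irreflexive (@path_edge n).
Proof. by move=> i; rewrite /path_edge /= orbb gtn_eqF. Qed.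

Definition path_graph (n : nat) : sgraph :=
  SGraph (@path_edge_sym n) (@path_edge_irrefl n).

Definition adjacency (R : realType) (G : sgraph) : 'M[R]_#|G| :=
  \matrix_(i, j) (edge (enum_val i) (enum_val j))%:R.

(* The real roots of the characteristic polynomial, each repeated according to
   its multiplicity; for symmetric A this is the whole spectrum, by
   char_poly_eigenvalues below. *)
Definition eigenvalues (R : realType) (n : nat) (A : 'M[R]_n) : seq R :=
  flatten [seq nseq (mup x (char_poly A)) x | x <- rootsR (char_poly A)].

Lemma char_poly_similar (F : fieldType) n (P A : 'M[F]_n) :
  P \in unitmx -> char_poly (invmx P *m A *m P) = char_poly A.
Proof.
move=> Pu.
have uP : map_mx polyC P \in unitmx by rewrite map_unitmx.
rewrite /char_poly.
have -> : char_poly_mx (invmx P *m A *m P) =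
    invmx (map_mx polyC P) *m char_poly_mx A *m map_mx polyC P.
  rewrite /char_poly_mx mulmxBr mulmxBl !map_mxM map_invmx /=.
  by rewrite scalar_mxC -[_%:M *m _ *m _]mulmxA mulVmx // mulmx1.
by rewrite !det_mulmx mulrAC -det_mulmx mulVmx // det1 mul1r.
Qed.

Lemma sym_char_poly_split (R : realType) n (A : 'M[R]_n) : A^T = A ->
  exists s : seq R, char_poly A = \prod_(x <- s) ('X - x%:P).
Proof.
move=> Asym.
pose f := real_complex R; pose B := map_mx f A.
have Breal : B \is a mxOver Num.real.
  by apply/mxOverP => i j; rewrite mxE; apply/complex_realP; exists (A i j).
have Bherm : B \is hermsymmx.
  apply: realsym_hermsym => //.
  by apply/is_hermitianmxP; rewrite expr0 scale1r map_mx_id // /B map_trmx Asym.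
have /hermitian_normalmx/orthomx_spectralP BE := Bherm.
have /mxOverP dreal := hermitian_spectral_diag_real Bherm.
set d := spectral_diag B in BE dreal.
exists [seq complex.Re (d 0 i) | i <- enum 'I_n].
apply: (@map_poly_inj _ _ f).
rewrite map_char_poly -/B BE char_poly_similar ?spectral_unit //.
rewrite char_poly_trig ?diag_mx_is_trig // big_map big_enum /= rmorph_prod /=.
apply: eq_bigr => i _; rewrite rmorphB /= map_polyX map_polyC /= !mxE eqxx mulr1n.
by congr ('X - _%:P); rewrite /f /= RRe_real.
Qed.

Lemma char_poly_eigenvalues (R : realType) n (A : 'M[R]_n) : A^T = A ->
  char_poly A = \prod_(x <- eigenvalues A) ('X - x%:P).
Proof.
move=> /sym_char_poly_split[s sE]; rewrite [LHS]sE.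
have p0 : char_poly A != 0 by rewrite monic_neq0 ?char_poly_monic.
apply: perm_big; apply/allP => x _ /=; apply/eqP.
have uR : uniq (rootsR (char_poly A)) by exact/uniq_roots.
rewrite -mu_prod_XsubC -sE /eigenvalues count_flatten -map_comp sumnE big_map /=.
under eq_bigr do rewrite count_nseq /=.
have [xR|xR] := boolP (x \in rootsR (char_poly A)).
  by rewrite (bigD1_seq x) //= eqxx mul1n big1 ?addn0 // => y /negPf ->; rewrite mul0n.
rewrite mupNroot; last first.
  by have := roots_on_rootsR p0 x; rewrite in_itv /= => ->.
rewrite big_seq big1 // => y yR.
by have [xy|] := eqVneq y x; [rewrite -xy yR in xR | rewrite mul0n].
Qed.

Lemma adjacency_sym (R : realType) (G : sgraph) :
  (adjacency R G)^T = adjacency R G.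
Proof. by apply/matrixP => i j; rewrite !mxE edge_sym. Qed.

Lemma size_eigenvalues_adjacency (R : realType) (G : sgraph) :
  size (eigenvalues (adjacency R G)) = #|G|.
Proof.
have := congr1 (fun q : {poly R} => size q)
  (char_poly_eigenvalues (adjacency_sym R G)).
by rewrite size_char_poly size_prod_XsubC => -[].
Qed.

Definition pos_energy (R : realType) (p : R) (G : sgraph) : R :=
  \sum_(x <- eigenvalues (adjacency R G) | 0 < x) x `^ p.

(* Main.v *)
Require Import Defs.
From mathcomp Require Import all_boot all_order all_algebra.
From mathcomp Require Import complex.
From mathcomp Require Import reals exp.
From mathcomp Require Import boolp classical_sets functions topology normedtype sequences derive realfun.
From mathcomp Require Import constructive_ereal ereal measure lebesgue_measure lebesgue_integral ftc.
From mathcomp Require Import ring lra.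
From mathcomp Require Import finset.

(** For a symmetric matrix A with spectrum symmetric about 0, half the logarithm of
   det (1 + y A ^ 2) is the sum of ln (1 + y a) over the squares a of the positive
   eigenvalues, and the positive p-energy is the sum of a ^ q with q = p / 2 >= 1.
   The theorem follows from a comparison of these logarithms as functions of y > 0.

   Energies from logarithms.  For m < q < m + 1 the power a ^ q is a positive constant
   times the integral over y > 0 of y ^ (- q - 1) times the Taylor error of order m of
   ln (1 + y a), with the sign that makes it nonnegative.  Hence it is enough that for
   every order m >= 1 the Taylor errors of the logarithm for the path minus those of
   the logarithm for G have the sign of the m-th term of the expansion of
   ln (1 + y); in other words, that the difference is [alternating 1].  This is
   [power_sum_le]; integer q are limits.

   Enveloping series.  A function is [enveloped] by a series with nonnegative
   coefficients if each truncation error has the sign of the first omitted term.  Such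
   functions are stable under sums, products and the passage from g to 1 / (1 + y g),
   and the Green functions [green A y b] = b^T (1 + y A ^ 2)^-1 b are among them, with
   moments |A ^ k b| ^ 2 as coefficients.  A comparison of Green functions passes to
   logarithms by [ln_ratio_alternating].

   Graphs.  In a bipartite graph a vertex u can be eliminated with a Schur complement
   in which only the Green function of the rest at the neighbours of u enters
   ([green_vertex], [fdet_vertex]).  The components left by the removal of u enter
   additively, so each of them may be regarded as a weight at u.  The statement proved
   by induction on connected sets, [path_dominates], therefore allows an arbitrary
   enveloped weight at a root: the components at the root are replaced one by one by
   paths, and two paths that meet at the root are merged into one.  All steps but one
   reduce to explicit identities between continued fractions ([pfunD], [plogD]).  The
   exception is a component C that is joined to u by several edges.  There the Green
   function of C is compared directly with that of an end of a path
   ([cycle_alternating]): all moments are at least twice those of the path, because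
   among connected graphs the end of a path has the fewest closed walks
   ([pcoef_le_moment]), and Cauchy-Schwarz bounds control the errors. *)

Set Implicit Arguments.
Unset Strict Implicit.
Unset Printing Implicit Defensive.

Import Order.TTheory GRing.Theory Num.Theory.
Import numFieldNormedType.Exports.
Local Open Scope ring_scope.

(** * Enveloping series *)

Section CoefficientSequences.
Variable K : comNzRingType.
Implicit Types c d g : nat -> K.

(** Cauchy product of two series. *)
Definition conv c d k := \sum_(i < k.+1) c i * d (k - i)%N.

(** The recursion for [geom] needs all the earlier coefficients, so the list of
   them is built instead. *)
Fixpoint geom_list g n : seq K :=
  if n is m.+1 then
    let s := geom_list g m in
    rcons s (\sum_(i < m.+1) g i * s`_(m - i))
  else [:: 1].

(** Series of 1 / (1 + y g) in powers of - y, when [g] is that of g. *)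
Definition geom g n : K := (geom_list g n)`_n.

Definition alt_sum c i (y : K) := \sum_(k < i.+1) c k * (- y) ^+ k.

Lemma size_geom_list g n : size (geom_list g n) = n.+1.
Proof. by elim: n => //= n IH; rewrite size_rcons IH. Qed.

Lemma nth_geom_list g n k : (k <= n)%N -> (geom_list g n)`_k = geom g k.
Proof.
elim: n => [|n IH]; first by case: k.
rewrite leq_eqVlt => /orP[/eqP->//|]; rewrite ltnS => kn.
by rewrite /= nth_rcons size_geom_list ltnS kn IH.
Qed.

Lemma geom0 g : geom g 0 = 1. Proof. by []. Qed.

Lemma geomS g n : geom g n.+1 = conv g (geom g) n.
Proof.
rewrite /geom /= nth_rcons size_geom_list ltnn eqxx /conv.
by apply: eq_bigr => i _; rewrite nth_geom_list // leq_subr.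
Qed.

Lemma alt_sum0 c y : alt_sum c 0 y = c 0%N.
Proof. by rewrite /alt_sum big_ord1 expr0 mulr1. Qed.

Lemma alt_sumS c i y :
  alt_sum c i.+1 y = alt_sum c i y + c i.+1 * (- y) ^+ i.+1.
Proof. by rewrite /alt_sum big_ord_recr. Qed.

Lemma alt_sum_shift c i y :
  alt_sum c i.+1 y = c 0%N - y * alt_sum (fun k => c k.+1) i y.
Proof.
rewrite /alt_sum big_ord_recl expr0 mulr1 mulr_sumr -sumrN; congr (_ + _).
by apply: eq_bigr => k _; rewrite exprS; ring.
Qed.

Lemma alt_sum_conv c d i y :
  alt_sum (conv c d) i y =
  \sum_(j < i.+1) c j * (- y) ^+ j * alt_sum d (i - j) y.
Proof.
elim: i => [|i IH].
  by rewrite alt_sum0 /conv !big_ord1 expr0 mulr1 alt_sum0.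
rewrite alt_sumS IH [RHS]big_ord_recr /= subnn alt_sum0.
have -> : conv c d i.+1 = \sum_(j < i.+1) c j * d (i.+1 - j)%N + c i.+1 * d 0%N.
  by rewrite /conv big_ord_recr /= subnn.
rewrite mulrDl addrA.
congr (_ + _); last by ring.
rewrite mulr_suml -big_split /=; apply: eq_bigr => j _.
have ji : (j <= i)%N by rewrite -ltnS.
rewrite subSn // alt_sumS.
have -> : (- y) ^+ i.+1 = (- y) ^+ j * (- y) ^+ (i - j).+1.
  by rewrite -exprD addnS subnKC.
ring.
Qed.

Lemma alt_sumD c d i y :
  alt_sum (fun k => c k + d k) i y = alt_sum c i y + alt_sum d i y.
Proof. by rewrite /alt_sum -big_split; apply: eq_bigr => k _; rewrite mulrDl. Qed.

Lemma alt_sumB c d i y :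
  alt_sum (fun k => c k - d k) i y = alt_sum c i y - alt_sum d i y.
Proof.
by rewrite /alt_sum -sumrB; apply: eq_bigr => k _; rewrite mulrBl.
Qed.

End CoefficientSequences.

Section CoefficientMorphism.
Variables (K L : comNzRingType) (f : {rmorphism K -> L}).

Lemma conv_rmorph c d k :
  f (conv c d k) = conv (fun i => f (c i)) (fun i => f (d i)) k.
Proof. by rewrite rmorph_sum; apply: eq_bigr => i _; rewrite rmorphM. Qed.

Lemma geom_rmorph g n : f (geom g n) = geom (fun i => f (g i)) n.
Proof.
elim/ltn_ind: n => -[|n] IH; first by rewrite !geom0 rmorph1.
rewrite !geomS conv_rmorph /conv; apply: eq_bigr => i _.
by rewrite IH // ltnS leq_subr.
Qed.

End CoefficientMorphism.

Section Enveloping.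
Variable R : realFieldType.
Implicit Types (f g h : R -> R) (c d e : nat -> R) (y : R).

(** Every truncation error has the sign of the first omitted power of - y.  The
   threshold [i0] is there because graphs compare from order 1 on only: at order
   0 a star and a path compare the other way round for large y. *)
Definition alternating i0 f c := forall i y, (i0 <= i)%N -> 0 < y ->
  0 <= (-1) ^+ i.+1 * (f y - alt_sum c i y).

Definition enveloped f c :=
  [/\ forall k, 0 <= c k, forall y, 0 < y -> 0 <= f y & alternating 0 f c].

Lemma sign_sqr n : (-1) ^+ n * (-1) ^+ n = 1 :> R.
Proof. by rewrite -exprD addnn -mul2n exprM sqrrN expr1n expr1n. Qed.

Lemma sign_split i j (a y x : R) : (j <= i)%N ->
  (-1) ^+ i.+1 * (a * (- y) ^+ j * x) =
  a * y ^+ j * ((-1) ^+ (i - j).+1 * x).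
Proof.
move=> ji; rewrite -[- y]mulN1r exprMn -{1}(subnK ji) -addSn exprD.
have := sign_sqr j; move: ((-1) ^+ j) ((-1) ^+ (i - j).+1) => s t E.
move: (y ^+ j) => Y; have -> : a * Y * (t * x) = s * s * (a * Y * (t * x)).
  by rewrite E mul1r.
by ring.
Qed.

Lemma eq_alternating i0 f g c : (forall y, 0 < y -> f y = g y) ->
  alternating i0 f c -> alternating i0 g c.
Proof. by move=> fg fc i y ii y0; rewrite -fg //; apply: fc. Qed.

Lemma alternating_le i0 i1 f c : (i0 <= i1)%N ->
  alternating i0 f c -> alternating i1 f c.
Proof. by move=> i01 fc i y ii; apply: fc; apply: leq_trans ii. Qed.

Lemma alternatingD i0 f g c d : alternating i0 f c -> alternating i0 g d ->
  alternating i0 (fun y => f y + g y) (fun k => c k + d k).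
Proof.
move=> fc gd i y ii y0; rewrite alt_sumD.
have := addr_ge0 (fc i y ii y0) (gd i y ii y0).
by rewrite -mulrDr; congr (0 <= _ * _); ring.
Qed.

(** The error of a truncated product is the error of the first factor times the
   second, plus the terms of the first times errors of the second. *)
Lemma alternatingM i0 f g c d : (forall k, 0 <= c k) -> alternating i0 f c ->
  enveloped g d -> alternating i0 (fun y => f y * g y) (conv c d).
Proof.
move=> c0 fc [d0 g0 gd] i y ii y0; rewrite alt_sum_conv.
have -> : f y * g y - \sum_(j < i.+1) c j * (- y) ^+ j * alt_sum d (i - j) y =
   (f y - alt_sum c i y) * g y +
   \sum_(j < i.+1) c j * (- y) ^+ j * (g y - alt_sum d (i - j) y).
  under [X in _ = _ + X]eq_bigr do rewrite mulrBr.
  by rewrite sumrB -mulr_suml -/(alt_sum c i y); ring.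
rewrite mulrDr addr_ge0 //; first by rewrite mulrA mulr_ge0 ?fc ?g0.
rewrite mulr_sumr sumr_ge0 // => j _.
have ji : (j <= i)%N by rewrite -ltnS.
rewrite sign_split // mulr_ge0 ?gd // mulr_ge0 ?exprn_ge0 //.
exact: ltW.
Qed.

Lemma conv_ge0 c d : (forall k, 0 <= c k) -> (forall k, 0 <= d k) ->
  forall k, 0 <= conv c d k.
Proof. by move=> c0 d0 k; apply: sumr_ge0 => i _; apply: mulr_ge0. Qed.

Lemma geom_ge0 c : (forall k, 0 <= c k) -> forall k, 0 <= geom c k.
Proof.
move=> c0; elim/ltn_ind => -[|k] IH; first exact: ler01.
by rewrite geomS sumr_ge0 // => i _; rewrite mulr_ge0 // IH // ltnS leq_subr.
Qed.

Lemma envelopedD f g c d : enveloped f c -> enveloped g d ->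
  enveloped (fun y => f y + g y) (fun k => c k + d k).
Proof.
move=> [c0 f0 fc] [d0 g0 gd]; split; last exact: alternatingD.
  by move=> k; rewrite addr_ge0.
by move=> y y0; rewrite addr_ge0 ?f0 ?g0.
Qed.

Lemma envelopedM f g c d : enveloped f c -> enveloped g d ->
  enveloped (fun y => f y * g y) (conv c d).
Proof.
move=> [c0 f0 fc] gd; case: (gd) => d0 g0 _.
split; [exact: conv_ge0 | by move=> y y0; rewrite mulr_ge0 ?f0 ?g0|].
exact: alternatingM.
Qed.

Lemma alternatingZ i0 a f c : 0 <= a -> alternating i0 f c ->
  alternating i0 (fun y => a * f y) (fun k => a * c k).
Proof.
move=> a0 fc i y ii y0; have := mulr_ge0 a0 (fc i y ii y0).
congr (0 <= _); rewrite /alt_sum mulrCA mulrBr mulr_sumr; congr (_ * (_ - _)).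
by apply: eq_bigr => k _; rewrite mulrA.
Qed.

Lemma envelopedZ a f c : 0 <= a -> enveloped f c ->
  enveloped (fun y => a * f y) (fun k => a * c k).
Proof.
move=> a0 [c0 f0 fc]; split; last exact: alternatingZ.
  by move=> k; rewrite mulr_ge0.
by move=> y y0; rewrite mulr_ge0 ?f0.
Qed.

Lemma enveloped0 : enveloped (fun=> 0) (fun=> 0).
Proof.
split=> // i y _ _; rewrite /alt_sum big1 ?subrr ?mulr0 // => k _.
by rewrite mul0r.
Qed.

(** For k = 1 / (1 + y g) the identity k = 1 - y g k expresses an error of k as - y
   times an error of the product g k of one order less; as in [alternatingM] the
   latter splits into errors of g and errors of k of lower order. *)
Lemma enveloped_geom g c : enveloped g c ->
  enveloped (fun y => (1 + y * g y)^-1) (geom c).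
Proof.
move=> [c0 g0 gc].
have pos y : 0 < y -> 0 < 1 + y * g y.
  by move=> y0; rewrite ltr_pwDl // mulr_ge0 ?g0 // ltW.
split; [exact: geom_ge0 | by move=> y y0; rewrite invr_ge0 ltW ?pos|].
move=> i y _ y0; set k := (1 + y * g y)^-1.
have kE : k = 1 - y * (g y * k).
  have := pos y y0; rewrite /k => /lt0r_neq0 n0; field => //.
have k0 : 0 <= k by rewrite invr_ge0 ltW ?pos.
clearbody k; elim/ltn_ind: i => -[_|i IH].
  rewrite alt_sum0 geom0 expr1 mulN1r opprB.
  have -> : 1 - k = y * (g y * k) by rewrite [X in 1 - X]kE subKr.
  by rewrite mulr_ge0 ?(ltW y0) // mulr_ge0 // g0.
rewrite alt_sum_shift geom0 [X in _ - y * X](_ : _ = alt_sum (conv c (geom c)) i y);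
  last by apply: eq_bigr => j _; rewrite geomS.
rewrite alt_sum_conv.
have -> : k - (1 - y * (\sum_(j < i.+1)
    c j * (- y) ^+ j * alt_sum (geom c) (i - j) y)) =
   - y * ((g y - alt_sum c i y) * k +
   \sum_(j < i.+1) c j * (- y) ^+ j * (k - alt_sum (geom c) (i - j) y)).
  under [X in _ = _ * (_ + X)]eq_bigr do rewrite mulrBr.
  rewrite sumrB -mulr_suml -/(alt_sum c i y); move: (\sum_(j < _) _) => W.
  by rewrite [X in X - (1 - _)]kE; ring.
set W := (X in - y * X); have -> : (-1) ^+ i.+2 * (- y * W) = y * ((-1) ^+ i.+1 * W).
  by rewrite exprS; ring.
rewrite /W; apply: mulr_ge0; first exact: ltW.
rewrite mulrDr addr_ge0 //; first by rewrite mulrA mulr_ge0 ?gc.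
rewrite mulr_sumr sumr_ge0 // => j _.
have ji : (j <= i)%N by rewrite -ltnS.
rewrite sign_split //; apply: mulr_ge0; first by rewrite mulr_ge0 ?exprn_ge0 // ltW.
by apply: IH; rewrite ltnS leq_subr.
Qed.

(** Two consecutive errors have opposite signs, so each is at most the term by
   which they differ. *)
Lemma alternating_bound i0 f c i y : alternating i0 f c -> (i0 <= i)%N ->
  0 < y -> `|f y - alt_sum c i y| <= c i.+1 * y ^+ i.+1.
Proof.
move=> fc ii y0; have h1 := fc i y ii y0; have h2 := fc i.+1 y (leqW ii) y0.
have -> : `|f y - alt_sum c i y| = (-1) ^+ i.+1 * (f y - alt_sum c i y).
  by rewrite -[RHS]ger0_norm // normrM normrX normrN1 expr1n mul1r.
rewrite -subr_ge0; move: h2; congr (0 <= _).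
rewrite alt_sumS exprS -[- y]mulN1r exprMn.
have := sign_sqr i.+1; move: ((-1) ^+ i.+1) => s E.
by move: (y ^+ i.+1) => Y; have -> : c i.+1 * Y = s * s * (c i.+1 * Y); [rewrite E mul1r | ring].
Qed.

Lemma alt_sum_norm_le c i y : 0 < y -> y <= 1 ->
  `|alt_sum c i y| <= \sum_(k < i.+1) `|c k|.
Proof.
move=> y0 y1; apply: le_trans (ler_norm_sum _ _ _) _.
apply: ler_sum => k _; rewrite normrM normrX normrN (gtr0_norm y0).
by rewrite ler_piMr // exprn_ile1 // ltW.
Qed.

Lemma small_eq0 (a B : R) :
  (forall y, 0 < y -> y <= 1 -> `|a| <= y * B) -> a = 0.
Proof.
move=> H; apply/eqP/negPn/negP; rewrite -normr_gt0 => a0.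
have B0 : 0 <= B by have := H 1 ltr01 (lexx _); rewrite mul1r => /(le_trans (ltW a0)).
have den : 0 < B + `|a| by rewrite ltr_wpDl.
have := H (`|a| / (B + `|a|)) (divr_gt0 a0 den).
rewrite ler_pdivrMr // mul1r lerDr => /(_ B0).
rewrite mulrAC ler_pdivlMr // ler_pM2l // gerDl => /(lt_le_trans a0).
by rewrite ltxx.
Qed.

Lemma alt_sum_small_eq0 i c (M : R) :
  (forall y, 0 < y -> y <= 1 -> `|alt_sum c i y| <= M * y ^+ i.+1) ->
  forall k, (k <= i)%N -> c k = 0.
Proof.
elim: i c => [|i IH] c H.
  move=> k; rewrite leqn0 => /eqP ->; apply: (@small_eq0 _ M) => y y0 y1.
  by have := H y y0 y1; rewrite alt_sum0 expr1 mulrC.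
have c0 : c 0%N = 0.
  have M0 : 0 <= M.
    by have := H 1 ltr01 (lexx _); rewrite expr1n mulr1; apply: le_trans.
  apply: (@small_eq0 _ (M + \sum_(k < i.+1) `|c k.+1|)) => y y0 y1.
  have := H y y0 y1; rewrite alt_sum_shift => h.
  have -> : c 0%N = (c 0%N - y * alt_sum (fun k => c k.+1) i y) +
                    y * alt_sum (fun k => c k.+1) i y by rewrite subrK.
  apply: le_trans (ler_normD _ _) _; rewrite mulrDr lerD //.
    apply: le_trans h _; rewrite exprS mulrCA ler_pM2l //.
    by rewrite ler_piMr // exprn_ile1 // ltW.
  rewrite normrM (gtr0_norm y0) ler_pM2l //.
  exact: (@alt_sum_norm_le (fun k => c k.+1)).
move=> [//|k]; rewrite ltnS; apply: (IH (fun k => c k.+1)) => y y0 y1.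
have := H y y0 y1; rewrite alt_sum_shift c0 sub0r normrN normrM (gtr0_norm y0).
by rewrite [_ ^+ i.+2]exprS mulrCA ler_pM2l.
Qed.

(** By [alternating_bound] the series is asymptotic at 0, hence unique. *)
Lemma alternating_unique i0 f c d :
  alternating i0 f c -> alternating i0 f d -> c =1 d.
Proof.
move=> fc fd k; apply/eqP; rewrite -subr_eq0; apply/eqP.
pose i := maxn i0 k; have ii : (i0 <= i)%N by rewrite leq_maxl.
have ki : (k <= i)%N by exact: leq_maxr.
apply: (@alt_sum_small_eq0 i (fun k => c k - d k) (c i.+1 + d i.+1)) ki.
move=> y y0 y1; rewrite alt_sumB.
have -> : alt_sum c i y - alt_sum d i y =
   - (f y - alt_sum c i y) + (f y - alt_sum d i y) by ring.
apply: le_trans (ler_normD _ _) _; rewrite normrN mulrDl.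
by rewrite lerD // (alternating_bound fc, alternating_bound fd).
Qed.

End Enveloping.

(** * Logarithms *)

Section Analysis.
Variable R : realType.
Implicit Types (f g h df : R -> R) (c d : nat -> R) (x y : R).

Lemma derive_ge0_le f df (a b : R) : a <= b ->
  (forall x, a <= x <= b -> is_derive x 1 f (df x)) ->
  (forall x, a <= x <= b -> 0 <= df x) -> f a <= f b.
Proof.
move=> ab fd df0.
have [||z zab E] := @MVT_segment R f df a b ab.
- by move=> x; rewrite in_itv /= => /andP[ax xb]; apply: fd; rewrite !ltW.
- apply: derivable_within_continuous => x; rewrite in_itv /= => xab.
  exact: (@ex_derive _ _ _ _ _ _ _ (fd x xab)).
by rewrite -subr_ge0 E mulr_ge0 ?subr_ge0 // df0.
Qed.

Definition antideriv (p : {poly R}) : {poly R} :=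
  \poly_(i < (size p).+1) (p`_i.-1 / i%:R).

Lemma antiderivK p : (antideriv p)^`() = p.
Proof.
apply/polyP => i; rewrite coef_deriv coef_poly ltnS /=.
case: ltnP => [_|pi]; last by rewrite mul0rn nth_default.
by rewrite -[LHS]mulr_natr divfK // pnatr_eq0.
Qed.

Lemma antideriv0 p : (antideriv p).[0] = 0.
Proof. by rewrite horner_coef0 coef_poly /= invr0 mulr0. Qed.

Lemma is_derive_ln_poly (s x : R) (A S : {poly R}) : 0 < A.[x] ->
  is_derive x 1 (s *: (@ln R \o horner A) + horner S)
    (s * (A.[x]^-1 * A^`().[x]) + S^`().[x]).
Proof.
move=> A0; have dl := is_derive1_comp (is_derive1_ln A0) (is_derive_poly A x).
by have := is_deriveD (is_deriveZ s dl) (is_derive_poly S x).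
Qed.

(** Put h := g2 - g1 and g_t := g1 + t h.  The derivative of ln (1 + y g_t) in t is
   y h / (1 + y g_t), where h is alternating from order [i0] and the other factor
   is enveloped by [enveloped_geom]; the factor y raises the order by one, and
   integration over 0 <= t <= 1 preserves signs.  The coefficients of the integrand
   are polynomials in t, so they are handled as elements of [{poly R}] and the
   integral is replaced by the monotonicity of the error as a function of t. *)
Lemma ln_ratio_alternating i0 g1 g2 c1 c2 :
  enveloped g1 c1 -> enveloped g2 c2 -> (forall k, c1 k <= c2 k) ->
  alternating i0 (fun y => g2 y - g1 y) (fun k => c2 k - c1 k) ->
  exists d, [/\ d 0%N = 0, d 1%N = c2 0%N - c1 0%N &
    alternating i0.+1 (fun y => ln (1 + y * g1 y) - ln (1 + y * g2 y)) d].
Proof.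
move=> g1e g2e c12 hc.
pose eta k := c2 k - c1 k.
pose P k : {poly R} := conv (fun j => (eta j)%:P)
  (geom (fun j => (c1 j)%:P + 'X * (eta j)%:P)) k.
pose D k := if k is j.+1 then P j else 0.
have PE k t : (P k).[t] = conv eta (geom (fun j => c1 j + t * eta j)) k.
  rewrite -horner_evalE conv_rmorph /conv; apply: eq_bigr => i _.
  rewrite geom_rmorph /= horner_evalE hornerC; congr (_ * geom _ _).
  by apply/funext => j; rewrite horner_evalE !hornerE.
exists (fun k => (antideriv (D k)).[1]); split.
- rewrite /= horner_coef big1 // => i _; rewrite coef_poly.
  by case: ifP => _; rewrite ?coef0 ?mul0r.
- rewrite /= /P /conv big_ord1 geom0 mulr1 /antideriv.
  have <- : eta 0%N = c2 0%N - c1 0%N by [].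
  have [->|nz] := eqVneq (eta 0%N) 0.
    rewrite horner_coef big1 // => i _; rewrite coef_poly.
    by case: ifP => _; rewrite ?coef0 ?mul0r.
  rewrite size_polyC nz /= poly_def !big_ord_recl big_ord0 /= !hornerE.
  by rewrite /= ?invr0 ?mulr0 ?mul0r ?add0r addr0 coefC /= divr1.
move=> i y ii y0; case: i ii => // i; rewrite ltnS => ii.
set h := fun y => g2 y - g1 y in hc.
have [[c10 g10 g1a] [c20 g20 g2a]] := (g1e, g2e).
have gte t : 0 <= t <= 1 ->
    enveloped (fun y => g1 y + t * h y) (fun k => c1 k + t * eta k).
  move=> /andP[t0 t1].
  have := envelopedD (envelopedZ (_ : 0 <= 1 - t) g1e) (envelopedZ t0 g2e).
  rewrite subr_ge0 => /(_ t1) [k0 f0 fa]; split.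
  - by move=> k; move: (k0 k); rewrite /eta; congr (0 <= _); ring.
  - by move=> z z0; move: (f0 z z0); rewrite /h; congr (0 <= _); ring.
  - move=> j z _ z0; move: (fa j z isT z0); congr (0 <= _ * (_ - _)).
      by rewrite /h; ring.
    by apply: eq_bigr => k _; rewrite /eta; ring.
have pos t : 0 <= t <= 1 -> 0 < 1 + y * (g1 y + t * h y).
  by move=> /gte[_ /(_ y y0) ge _]; rewrite ltr_pwDl // mulr_ge0 // ltW.
(* the truncated expansion of the logarithm of the quotient, as a polynomial in t *)
pose S : {poly R} := \sum_(k < i.+2) antideriv (D k) * ((- y) ^+ k)%:P.
have SE t : S.[t] = alt_sum (fun k => (antideriv (D k)).[t]) i.+1 y.
  by rewrite horner_sum; apply: eq_bigr => k _; rewrite hornerM hornerC.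
pose A : {poly R} := (1 + y * g1 y)%:P + (y * h y) *: 'X.
have AE t : A.[t] = 1 + y * (g1 y + t * h y) by rewrite /A !hornerE; ring.
have dA t : A^`().[t] = y * h y.
  by rewrite /A derivD derivC derivZ derivX !hornerE; ring.
pose s : R := (-1) ^+ i.+2.
pose Q : {poly R} := (s * ln (1 + y * g1 y))%:P - s *: S.
have W01 : 0 <= 1 :> R by [].
have : (- s *: (@ln R \o horner A) + horner Q) 0 <=
       (- s *: (@ln R \o horner A) + horner Q) 1.
  apply: (derive_ge0_le W01 (fun t t01 => is_derive_ln_poly _ _ _)) => t t01.
    by rewrite AE pos.
  rewrite AE dA /Q derivB derivC derivZ !hornerE.
  have -> : S^`().[t] = - y * alt_sum (fun k => (P k).[t]) i y.
    rewrite raddf_sum horner_sum big_ord_recl /= derivM derivC mulr0 addr0.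
    rewrite antiderivK mul0r horner0 add0r /alt_sum mulr_sumr.
    apply: eq_bigr => k _; rewrite derivM derivC mulr0 addr0 antiderivK.
    by rewrite !hornerE exprS /=; ring.
  have [k0 f0 fa] := enveloped_geom (gte t t01).
  have := alternatingM _ hc (enveloped_geom (gte t t01)).
  have eta0 k : 0 <= eta k by rewrite subr_ge0.
  move=> /(_ eta0 i y ii y0).
  have -> : alt_sum (fun k => (P k).[t]) i y =
     alt_sum (conv eta (geom (fun j => c1 j + t * eta j))) i y.
    by apply: eq_bigr => k _; rewrite PE.
  move=> H; have := mulr_ge0 (ltW y0) H; rewrite /s [X in _ -> 0 <= X](_ : _ =
    y * ((-1) ^+ i.+1 * (h y / (1 + y * (g1 y + t * h y)) -
     alt_sum (conv eta (geom (fun j => c1 j + t * eta j))) i y))) //.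
  by rewrite exprS /=; ring.
rewrite !fctE /= !AE /Q !hornerD !hornerN !hornerZ !hornerC !SE /=.
have -> : alt_sum (fun k => (antideriv (D k)).[0]) i.+1 y = 0.
  by rewrite /alt_sum big1 // => k _; rewrite antideriv0 mul0r.
rewrite !mul0r !addr0 mul1r [g1 y + h y]addrC subrK.
by rewrite -subr_ge0; congr (0 <= _); rewrite /s /GRing.scale /=; ring.
Qed.
End Analysis.

Section PowerSums.
Variable R : realType.
Implicit Types (f g h df : R -> R) (c d : nat -> R) (x y : R).

(** Coefficients of - ln (1 + x) in powers of - x; the convention 0^-1 = 0 gives the
   missing constant term. *)
Definition ln_coef (k : nat) : R := k%:R^-1.

(** The sign makes the Taylor error nonnegative: its derivative is
   x ^ m / (1 + x). *)
Definition ln_tail m (x : R) : R :=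
  (-1) ^+ m.+1 * (- ln (1 + x) - alt_sum ln_coef m x).

Definition ln_poly m : {poly R} := \sum_(k < m.+1) (ln_coef k *: (- 'X) ^+ k).

Lemma ln_polyE m x : (ln_poly m).[x] = alt_sum ln_coef m x.
Proof.
rewrite horner_sum; apply: eq_bigr => k _.
by rewrite hornerZ horner_exp hornerN hornerX.
Qed.

Lemma deriv_ln_poly m x : 0 <= x ->
  (ln_poly m)^`().[x] = ((- x) ^+ m - 1) / (1 + x).
Proof.
move=> x0; have x1 : 1 + x != 0 by rewrite gt_eqF // ltr_pwDl.
elim: m => [|m IH].
  by rewrite /ln_poly big_ord1 expr0 derivZ derivC scaler0 horner0 subrr mul0r.
rewrite /ln_poly big_ord_recr /= derivD hornerD IH derivZ hornerZ deriv_exp.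
rewrite derivN derivX /= hornerMn hornerM hornerN hornerC horner_exp hornerN.
rewrite hornerX /ln_coef -[(_ * _) *+ _]mulr_natl mulKf ?pnatr_eq0 //.
rewrite exprS; move: ((- x) ^+ m) => X.
by field.
Qed.

Lemma is_derive_ln_tail m x : 0 <= x ->
  is_derive x 1 (ln_tail m) (x ^+ m / (1 + x)).
Proof.
move=> x0; have x1 : 1 + x != 0 by rewrite gt_eqF // ltr_pwDl.
have A0 : 0 < (1 + 'X : {poly R}).[x] by rewrite !hornerE ltr_pwDl.
have := is_derive_ln_poly (- (-1) ^+ m.+1) (- (-1) ^+ m.+1 *: ln_poly m) A0.
have -> : - (-1) ^+ m.+1 *: (@ln R \o horner (1 + 'X)) +
     horner (- (-1) ^+ m.+1 *: ln_poly m) = ln_tail m.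
  apply/funext => t; rewrite /ln_tail -ln_polyE !fctE /= hornerZ.
  rewrite hornerD hornerC hornerX /GRing.scale /=; ring.
move=> D; apply: trigger_derive D _.
rewrite derivD derivC derivX derivZ hornerZ deriv_ln_poly // !hornerE /=.
have := sign_sqr R m; rewrite exprS -[- x]mulN1r exprMn.
move: ((-1) ^+ m) (x ^+ m) => s X E.
have -> : X / (1 + x) = s * s * X / (1 + x) by rewrite E mul1r.
by field.
Qed.

Lemma ln_tail0 m : ln_tail m 0 = 0.
Proof.
rewrite /ln_tail addr0 ln1 oppr0 sub0r /alt_sum big_ord_recl /ln_coef invr0.
by rewrite mul0r add0r big1 ?oppr0 ?mulr0 // => k _; rewrite expr0n mulr0.
Qed.

Lemma ln_tail_mono m x y : 0 <= x -> x <= y -> ln_tail m x <= ln_tail m y.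
Proof.
move=> x0 xy.
apply: (derive_ge0_le xy (df := fun t => t ^+ m / (1 + t))) => t /andP[xt _].
  by apply: is_derive_ln_tail; apply: le_trans xt.
have t0 := le_trans x0 xt.
by rewrite divr_ge0 ?exprn_ge0 // addr_ge0.
Qed.

Lemma ln_tail_ge0 m x : 0 <= x -> 0 <= ln_tail m x.
Proof. by move=> x0; rewrite -(ln_tail0 m) ln_tail_mono. Qed.

Lemma ln_tailS m x : ln_tail m.+1 x = ln_coef m.+1 * x ^+ m.+1 - ln_tail m x.
Proof.
rewrite /ln_tail alt_sumS [(-1) ^+ m.+2]exprS -[in (- x) ^+ m.+1]mulN1r exprMn.
have := sign_sqr R m.+1; move: ((-1) ^+ m.+1) (x ^+ m.+1) => s X E.
have -> : ln_coef m.+1 * X = s * s * (ln_coef m.+1 * X) by rewrite E mul1r.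
by ring.
Qed.

Lemma ln_coef_le1 k (x : R) : 0 <= x -> ln_coef k * x ^+ k <= x ^+ k.
Proof.
move=> x0; rewrite ler_piMl ?exprn_ge0 // /ln_coef.
by case: k => [|k]; rewrite ?invr0 // invf_le1 ?ltr0n // ler1n.
Qed.

Lemma ln_tail_leS m x : 0 <= x -> ln_tail m x <= x ^+ m.+1.
Proof.
move=> x0; apply: le_trans (ln_coef_le1 m.+1 x0).
by rewrite -subr_ge0 -ln_tailS ln_tail_ge0.
Qed.

Lemma ln_tail_le m x : 0 <= x -> ln_tail m.+1 x <= x ^+ m.+1.
Proof.
move=> x0; apply: le_trans (ln_coef_le1 m.+1 x0).
by rewrite ln_tailS gerBl ln_tail_ge0.
Qed.

Lemma ln_tail1_gt0 m : 0 < ln_tail m 1.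
Proof.
have [||z z01 E] := @MVT R (ln_tail m) (fun t => t ^+ m / (1 + t)) 0 1 ltr01.
- move=> x; rewrite in_itv /= => /andP[x0 _]; apply: is_derive_ln_tail.
  exact: ltW.
- apply: derivable_within_continuous => x; rewrite in_itv /= => /andP[x0 _].
  exact: (@ex_derive _ _ _ _ _ _ _ (is_derive_ln_tail m x0)).
move: E; rewrite ln_tail0 !subr0 mulr1 => ->.
move: z01; rewrite in_itv /= => /andP[z0 _].
by rewrite divr_gt0 ?exprn_gt0 // addr_gt0.
Qed.

Lemma alternating_ln a : 0 <= a ->
  alternating 0 (fun y => - ln (1 + y * a)) (fun k => ln_coef k * a ^+ k).
Proof.
move=> a0 i y _ y0; have := ln_tail_ge0 i (mulr_ge0 (ltW y0) a0).
rewrite /ln_tail /alt_sum; congr (0 <= _ * (_ - _)).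
by apply: eq_bigr => k _; rewrite -mulNr exprMn; ring.
Qed.

Lemma alternating_ln_sum (s : seq R) : all (>= 0) s ->
  alternating 0 (fun y => - \sum_(a <- s) ln (1 + y * a))
    (fun k => \sum_(a <- s) ln_coef k * a ^+ k).
Proof.
elim: s => [_|a s IH /=/andP[a0 /IH {}IH]].
  move=> i y _ _; rewrite big_nil oppr0 /alt_sum big1 ?subrr ?mulr0 // => k _.
  by rewrite big_nil mul0r.
move=> i y ii y0; have := alternatingD (alternating_ln a0) IH ii y0.
rewrite big_cons opprD /alt_sum; congr (0 <= _ * (_ - _)).
by apply: eq_bigr => k _; rewrite big_cons.
Qed.

(** The expansion being unique, [d] is the difference of the expansions of the two
   sums, and the errors in the hypothesis are differences of sums of [ln_tail]. *)
Lemma ln_tail_sum_le (s t : seq R) d m : all (>= 0) s -> all (>= 0) t ->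
  alternating 1 (fun y => \sum_(b <- t) ln (1 + y * b) -
                          \sum_(a <- s) ln (1 + y * a)) d ->
  (0 < m)%N -> forall y, 0 < y ->
  \sum_(b <- t) ln_tail m (y * b) <= \sum_(a <- s) ln_tail m (y * a).
Proof.
move=> s0 t0 ad m0 y y0.
have at1 := alternating_le (leq0n 1) (alternating_ln_sum t0).
have as1 := alternating_le (leq0n 1) (alternating_ln_sum s0).
have dE : d =1 fun k => \sum_(a <- s) ln_coef k * a ^+ k -
                        \sum_(b <- t) ln_coef k * b ^+ k.
  have := alternatingD ad at1.
  move/(eq_alternating (g := fun y => - \sum_(a <- s) ln (1 + y * a))).
  move=> /(_ _)/alternating_unique/(_ as1) H k.
  by rewrite -H ?addrK // => z _; rewrite addrAC subrr sub0r.
have tailE (r : seq R) : \sum_(a <- r) ln_tail m (y * a) = (-1) ^+ m.+1 *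
   (- \sum_(a <- r) ln (1 + y * a) -
    alt_sum (fun k => \sum_(a <- r) ln_coef k * a ^+ k) m y).
  elim: r => [|a r IH].
    rewrite !big_nil oppr0 /alt_sum big1 ?subrr ?mulr0 // => k _.
    by rewrite big_nil mul0r.
  rewrite big_cons IH /ln_tail -mulrDr big_cons; congr (_ * _).
  rewrite /alt_sum.
  have -> : \sum_(k < m.+1) (\sum_(b <- a :: r) ln_coef k * b ^+ k) *
      (- y) ^+ k = \sum_(k < m.+1) ln_coef k * a ^+ k * (- y) ^+ k +
      \sum_(k < m.+1) (\sum_(b <- r) ln_coef k * b ^+ k) * (- y) ^+ k.
    by rewrite -big_split; apply: eq_bigr => k _; rewrite big_cons mulrDl.
  have -> : \sum_(k < m.+1) ln_coef k * (- (y * a)) ^+ k =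
            \sum_(k < m.+1) ln_coef k * a ^+ k * (- y) ^+ k.
    by apply: eq_bigr => k _; rewrite -mulNr exprMn; ring.
  by ring.
rewrite -subr_ge0 !tailE -mulrBr.
have := ad m y m0 y0; congr (0 <= _ * _).
rewrite (_ : alt_sum d m y =
   alt_sum (fun k => \sum_(a <- s) ln_coef k * a ^+ k) m y -
   alt_sum (fun k => \sum_(b <- t) ln_coef k * b ^+ k) m y); first by ring.
by rewrite -alt_sumB; apply: eq_bigr => k _; rewrite dE.
Qed.

Lemma antiderivative_exists f (u v : R) : 0 < u -> u < v ->
  (forall x, 0 < x -> {for x, continuous f}) ->
  exists F : R -> R, forall x, u < x < v -> is_derive x 1 F (f x).
Proof.
move=> u0 uv fc.
exists (fun x => \int[lebesgue_measure]_(t in [set` `[u, x]]) f t)%R.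
move=> x /andP[ux xv].
have fi : lebesgue_measure.-integrable `[u, v] (EFin \o f).
  apply: continuous_compact_integrable; first exact: segment_compact.
  apply: continuous_in_subspaceT => z; rewrite in_setE /= in_itv /= => /andP[uz _].
  by apply: fc; apply: lt_le_trans uz.
have [df dE] := continuous_FTC1_closed xv fi ux (fc x (lt_trans u0 ux)).
by apply: DeriveDef; [exact: df | rewrite -dE derive1E].
Qed.

End PowerSums.

(** * Power sums as Mellin transforms *)

Section Mellin.
Variable R : realType.
Implicit Types (f g h df F : R -> R) (c d : nat -> R) (x y a : R) (s t : seq R).

(** For m < q < m + 1 the integral of this kernel over the positive half-line is
   finite and positive, and substituting y a for x turns the integral of
   ln_tail m (y a) y ^ (- q - 1) over y into a ^ q times that constant. *)
Definition kernel m q (x : R) : R := ln_tail m x * x `^ (- q - 1).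

Lemma kernel_continuous m q x : 0 < x -> {for x, continuous (kernel m q)}.
Proof.
move=> x0; apply: continuousM.
  apply: differentiable_continuous; apply/derivable1_diffP.
  exact: (@ex_derive _ _ _ _ _ _ _ (is_derive_ln_tail m (ltW x0))).
apply: differentiable_continuous; apply/derivable1_diffP.
exact: (@ex_derive _ _ _ _ _ _ _ (is_derive1_powR _ x0)).
Qed.

(** The substitution behind the Mellin representation of a ^ q, for an
   antiderivative [F] of the kernel. *)
Lemma is_derive_kernel_scale m q F u v a y : 0 < q -> 0 <= a -> 0 < y ->
  (forall x, u < x < v -> is_derive x 1 F (kernel m q x)) ->
  (0 < a -> u < y * a < v) ->
  is_derive y 1 (fun y => a `^ q * F (y * a)) (ln_tail m (y * a) * y `^ (- q - 1)).
Proof.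
move=> q0 a0 y0 dF; move: a0; rewrite le_eqVlt => /predU1P[<- _|a0 /(_ a0) uv].
  rewrite mulr0 ln_tail0 mul0r powR0 ?gt_eqF //.
  rewrite (_ : (fun=> _) = cst 0); last by apply/funext => z; rewrite mul0r.
  exact: is_derive_cst.
have dl : is_derive y 1 (horner (a *: 'X)) a.
  have := is_derive_poly (a *: 'X) y.
  by rewrite derivZ derivX hornerZ hornerC mulr1.
have e : (a *: 'X).[y] = y * a by rewrite hornerZ hornerX mulrC.
have dF' : is_derive ((a *: 'X).[y]) 1 F (kernel m q (y * a)).
  by rewrite e; exact: dF.
have D := is_deriveZ (a `^ q) (is_derive1_comp dF' dl).
rewrite (_ : (fun _ => _) = a `^ q *: (F \o horner (a *: 'X))); last first.
  apply/funext => z; change (a `^ q * F (z * a) = a `^ q * F (a *: 'X).[z]).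
  by rewrite hornerZ hornerX [a * z]mulrC.
apply: trigger_derive D _.
rewrite /kernel powRM ?ltW // /GRing.scale /=.
have -> : a `^ q = (a `^ (- q - 1))^-1 * a^-1.
  rewrite -powRN -[X in _ * X]powR_inv1 ?ltW // -powRD ?(gt_eqF a0) ?implybT //.
  by congr (_ `^ _); ring.
field; rewrite gt_eqF //= gt_eqF // powR_gt0 //.
Qed.

Lemma is_derive_kernel_sum m q F u v s y : 0 < q -> all (>= 0) s -> 0 < y ->
  (forall x, u < x < v -> is_derive x 1 F (kernel m q x)) ->
  (forall a, a \in s -> 0 < a -> u < y * a < v) ->
  is_derive y 1 (fun y => \sum_(a <- s) a `^ q * F (y * a))
    (\sum_(a <- s) ln_tail m (y * a) * y `^ (- q - 1)).
Proof.
move=> q0 + y0 dF; elim: s => [_ _|a s IH /=/andP[a0 s0] uv].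
  rewrite big_nil (_ : (fun=> _) = cst 0); first exact: is_derive_cst.
  by apply/funext => z; rewrite big_nil.
have D1 := is_derive_kernel_scale q0 a0 y0 dF (uv a (mem_head _ _)).
have D2 : is_derive y 1 (fun y => \sum_(a <- s) a `^ q * F (y * a))
    (\sum_(a <- s) ln_tail m (y * a) * y `^ (- q - 1)).
  by apply: IH => // b bs; apply: uv; rewrite inE bs orbT.
have := is_deriveD D1 D2; rewrite big_cons.
rewrite [X in _ -> is_derive _ _ X _](_ : _ =
  (fun y => a `^ q * F (y * a)) + fun y => \sum_(a <- s) a `^ q * F (y * a)) //.
by apply/funext => z; rewrite big_cons.
Qed.

Lemma derive_bounded_dist F df (lo hi k x y : R) :
  (forall z, lo <= z <= hi -> is_derive z 1 F (df z)) ->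
  (forall z, lo <= z <= hi -> 0 <= df z <= k) ->
  lo <= x <= hi -> lo <= y <= hi -> `|F x - F y| <= k * (hi - lo).
Proof.
move=> dF bd.
wlog xy : x y / x <= y.
  move=> H xb yb; have [xy|/ltW yx] := leP x y; first exact: H.
  by rewrite distrC; apply: H.
move=> /andP[lx xh] /andP[ly yh].
have inb z : x <= z <= y -> lo <= z <= hi.
  by move=> /andP[xz zy]; rewrite (le_trans lx xz) (le_trans zy yh).
have F1 : F x <= F y.
  apply: (derive_ge0_le xy (fun z zb => dF z (inb z zb))) => z zb.
  by have /andP[] := bd z (inb z zb).
have dP (z : R) : is_derive z 1 (horner (k *: 'X)) k.
  have := is_derive_poly (k *: 'X) z.
  by rewrite derivZ derivX hornerZ hornerC mulr1.
have F2 : (horner (k *: 'X) - F) x <= (horner (k *: 'X) - F) y.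
  apply: (derive_ge0_le xy (df := fun z => k - df z)) => z zb.
    exact: (is_deriveB (dP z) (dF z (inb z zb))).
  by rewrite subr_ge0; have /andP[] := bd z (inb z zb).
have k0 : 0 <= k.
  have /andP[h1 h2] : 0 <= df x <= k by apply: bd; rewrite lx xh.
  exact: le_trans h2.
have {}F2 : k * x - F x <= k * y - F y.
  have E z : k * z = (k *: 'X).[z] by rewrite hornerZ hornerX.
  by rewrite !E.
rewrite distrC ger0_norm ?subr_ge0 //.
have F3 : F y - F x <= k * (y - x) by lra.
apply: le_trans F3 _; rewrite ler_wpM2l // lerB //.
Qed.

Lemma powRN_small (al e : R) : 0 < al -> 0 < e ->
  exists2 Y0, 2 <= Y0 & forall Y, Y0 <= Y -> Y `^ (- al) <= e.
Proof.
move=> al0 e0; exists (Num.max 2 (e^-1 `^ al^-1)); first by rewrite le_max lexx.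
move=> Y; rewrite ge_max => /andP[Y2 YE].
have Y0 : 0 < Y by apply: lt_le_trans Y2.
rewrite powRN -[e]invrK lef_pV2 ?posrE ?invr_gt0 ?powR_gt0 //.
have : (e^-1 `^ al^-1) `^ al <= Y `^ al.
  by apply: ge0_ler_powR => //; rewrite ?nnegrE ?powR_ge0 // ltW.
by rewrite -powRrM mulVf ?gt_eqF // powRr1 // invr_ge0 ltW.
Qed.

Lemma powRN_le (p lo x : R) : 0 <= p -> 0 < lo -> lo <= x ->
  x `^ (- p) <= lo `^ (- p).
Proof.
move=> p0 lo0 lox; have x0 := lt_le_trans lo0 lox.
rewrite !powRN lef_pV2 ?posrE ?powR_gt0 //.
by apply: ge0_ler_powR; rewrite ?nnegrE // ltW.
Qed.

Lemma kernel_ge0 m q x : 0 <= x -> 0 <= kernel m q x.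
Proof. by move=> x0; rewrite mulr_ge0 ?ln_tail_ge0 ?powR_ge0. Qed.

Lemma kernel_ge m q x : 0 < q -> 1 <= x <= 2 ->
  ln_tail m 1 * 2 `^ (- q - 1) <= kernel m q x.
Proof.
move=> q0 /andP[x1 x2]; have x0 : 0 < x by apply: lt_le_trans x1.
apply: ler_pM; rewrite ?ln_tail_ge0 ?powR_ge0 ?ln_tail_mono //.
by rewrite -opprD powRN_le // addr_ge0 // ltW.
Qed.

Lemma kernel_le m q x : (0 < m)%N -> 0 < x ->
  kernel m q x <= x `^ (m%:R - q - 1).
Proof.
case: m => // m _ x0; rewrite -addrA powRD ?(gt_eqF x0) ?implybT //.
rewrite powR_mulrn ?(ltW x0) //.
by rewrite /kernel ler_wpM2r ?powR_ge0 // ln_tail_le // ltW.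
Qed.

Lemma kernel_leS m q x : 0 < x -> kernel m q x <= x `^ (m%:R - q).
Proof.
move=> x0; have -> : m%:R - q = m.+1%:R + (- q - 1) by rewrite -natr1; ring.
rewrite powRD ?(gt_eqF x0) ?implybT // powR_mulrn ?(ltW x0) //.
by rewrite /kernel ler_wpM2r ?powR_ge0 // ln_tail_leS // ltW.
Qed.

Lemma seq_scale_bound s : exists2 M : R, 1 <= M &
  forall a, a \in s -> 0 < a -> M^-1 <= a <= M.
Proof.
elim: s => [|b s [M M1 IH]]; first by exists 1.
have M0 : 0 < M by apply: lt_le_trans M1.
exists (M + `|b| + `|b|^-1).
  by rewrite -[1]addr0 -addrA lerD // addr_ge0 // invr_ge0.
move=> a; rewrite inE => /predU1P[->|as_] a0.
  rewrite gtr0_norm //; apply/andP; split; last first.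
    by rewrite addrAC lerDr addr_ge0 ?invr_ge0 ?(ltW a0) ?(ltW M0).
  rewrite invf_ple ?posrE // ?lerDr ?addr_ge0 ?(ltW M0) ?(ltW a0) //.
  by rewrite ltr_wpDr ?invr_ge0 ?(ltW a0) // addr_gt0.
have /andP[Ma aM] := IH a as_ a0.
have MM : M <= M + `|b| + `|b|^-1 by rewrite -addrA lerDl addr_ge0 // invr_ge0.
rewrite (le_trans aM MM) andbT (le_trans _ Ma) // lef_pV2 ?posrE //.
exact: lt_le_trans MM.
Qed.

(** Integrating the hypothesis against y ^ (- q - 1) over y > 0 multiplies the
   sums of q-th powers by the integral of [kernel m q].  Here the integral runs over
   the compact interval from Y^-1 to Y; the scaling by the elements of [s] and
   [t] moves its ends, which costs an error that tends to 0 as Y grows, by the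
   bounds x ^ (m - q - 1) at the upper and x ^ (m - q) at the lower end on the
   kernel. *)
Lemma power_sum_le_noninteger m q s t : (0 < m)%N -> m%:R < q -> q < m.+1%:R ->
  all (>= 0) s -> all (>= 0) t ->
  (forall y, 0 < y -> \sum_(b <- t) ln_tail m (y * b) <=
                      \sum_(a <- s) ln_tail m (y * a)) ->
  \sum_(b <- t) b `^ q <= \sum_(a <- s) a `^ q.
Proof.
move=> m0 mq qm s0 t0 H; rewrite leNgt; apply/negP => lt.
have q0 : 0 < q by apply: lt_trans mq; rewrite ltr0n.
set A := \sum_(a <- s) _ in lt; set B := \sum_(b <- t) _ in lt.
have A0 : 0 <= A by apply: sumr_ge0 => a _; exact: powR_ge0.
have B0 : 0 <= B by apply: sumr_ge0 => a _; exact: powR_ge0.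
have [M M1 HM] := seq_scale_bound (s ++ t).
have M0 : 0 < M by apply: lt_le_trans M1.
(* a lower bound for the integral of the kernel, from 1 <= x <= 2 alone *)
pose K0 := ln_tail m 1 * 2 `^ (- q - 1).
have K00 : 0 < K0 by rewrite mulr_gt0 ?ln_tail1_gt0 // powR_gt0.
pose al := q - m%:R; pose be := m.+1%:R - q.
have al0 : 0 < al by rewrite subr_gt0.
have be0 : 0 < be by rewrite subr_gt0.
pose C := M `^ (al + 1) * M + M `^ al * M.
have C0 : 0 < C by rewrite addr_gt0 // mulr_gt0 // powR_gt0.
(* small enough for the total error (A + B) * 2 * C * e to stay below (B - A) * K0 *)
pose e := (B - A) * K0 / ((A + B + 1) * C * 2).
have e0 : 0 < e.
  rewrite divr_gt0 //; first by rewrite mulr_gt0 // subr_gt0.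
  by rewrite !mulr_gt0 // ltr_wpDl // addr_ge0.
have [Y1 Y12 HY1] := powRN_small al0 e0.
have [Y2 Y22 HY2] := powRN_small be0 e0.
pose Y := Num.max Y1 Y2.
have Yge2 : 2 <= Y by rewrite le_max Y12.
have Y0 : 0 < Y by apply: lt_le_trans Yge2.
have small1 : Y `^ (- al) <= e by apply: HY1; rewrite le_max lexx.
have small2 : Y `^ (- be) <= e by apply: HY2; rewrite le_max lexx orbT.
(* an open interval around all the products y * a that occur *)
pose u := (Y * M)^-1 / 2; pose v := Y * M * 2.
have YM0 : 0 < Y * M by rewrite mulr_gt0.
have u0 : 0 < u by rewrite divr_gt0 ?invr_gt0.
have YM1 : 1 < Y * M.
  have : 2 * 1 <= Y * M by apply: ler_pM.
  by apply: lt_le_trans; rewrite mulr1 ltr1n.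
have Z0 : 0 < (Y * M)^-1 by rewrite invr_gt0.
have Z1 : (Y * M)^-1 < 1 by rewrite invf_lt1.
have uv : u < v by rewrite /u /v; lra.
have [F dF] := antiderivative_exists u0 uv (fun x => @kernel_continuous m q x).
pose Th := fun y => \sum_(a <- s) a `^ q * F (y * a) - \sum_(b <- t) b `^ q * F (y * b).
have inuv x : (Y * M)^-1 <= x <= Y * M -> u < x < v.
  by move=> /andP[x1 x2]; rewrite /u /v; apply/andP; split; lra.
have scale y a : a \in s ++ t -> 0 < a -> Y^-1 <= y <= Y -> (Y * M)^-1 <= y * a <= Y * M.
  move=> ain a0 /andP[y1 y2]; have /andP[a1 a2] := HM a ain a0.
  have Yi : 0 < Y^-1 by rewrite invr_gt0.
  have Mi : 0 < M^-1 by rewrite invr_gt0.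
  have y0 : 0 < y by apply: lt_le_trans y1.
  rewrite invfM; apply/andP; split; first by apply: ler_pM => //; apply: ltW.
  by apply: ler_pM => //; apply: ltW.
have Yi1 : Y^-1 <= 1 by rewrite invf_le1 // (le_trans _ Yge2) // ler1n.
have Y1' : 1 <= Y by rewrite (le_trans _ Yge2) // ler1n.
have YY : Y^-1 <= Y by apply: le_trans Y1'.
have mono : Th Y^-1 <= Th Y.
  apply: (derive_ge0_le YY (df := fun y =>
      \sum_(a <- s) ln_tail m (y * a) * y `^ (- q - 1) -
      \sum_(b <- t) ln_tail m (y * b) * y `^ (- q - 1))) => y yb.
    have y0 : 0 < y by have /andP[h _] := yb; apply: lt_le_trans h; rewrite invr_gt0.
    apply: is_deriveB.
      apply: (is_derive_kernel_sum q0 s0 y0 dF) => a ain a0.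
      by apply: inuv; apply: scale; rewrite // mem_cat ain.
    apply: (is_derive_kernel_sum q0 t0 y0 dF) => a ain a0.
    by apply: inuv; apply: scale; rewrite // mem_cat ain orbT.
  have y0 : 0 < y by have /andP[h _] := yb; apply: lt_le_trans h; rewrite invr_gt0.
  by rewrite subr_ge0 -!mulr_suml ler_wpM2r ?powR_ge0 // H.
pose D := F Y - F Y^-1.
pose err := C * (Y `^ (- al) + Y `^ (- be)).
have dFZ z : (Y * M)^-1 <= z <= Y * M -> is_derive z 1 F (kernel m q z).
  by move=> zb; apply/dF/inuv.
have Yi0 : 0 < Y^-1 by rewrite invr_gt0.
have YMi : (Y * M)^-1 <= Y^-1.
  by rewrite invfM ler_piMr ?(ltW Yi0) // invf_le1.
have YYM : Y <= Y * M by rewrite ler_peMr // ltW.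
have Fmono x y : Y^-1 <= x -> x <= y -> y <= Y -> F x <= F y.
  move=> x1 xy y2; apply: (derive_ge0_le xy (df := kernel m q)).
    move=> z /andP[xz zy]; apply: dFZ.
    by rewrite (le_trans YMi) ?(le_trans x1) // (le_trans zy) ?(le_trans y2).
  by move=> z /andP[xz zy]; rewrite kernel_ge0 // ltW // (lt_le_trans Yi0) ?(le_trans x1).
have D0 : K0 <= D.
  have le12 : 1 <= 2 :> R by rewrite ler1n.
  have h1 : F Y^-1 <= F 1 by apply: Fmono.
  have h2 : F 2 <= F Y by apply: Fmono => //; apply: le_trans Yi1 le12.
  have dP (z : R) : is_derive z 1 (horner (K0 *: 'X)) K0.
    have := is_derive_poly (K0 *: 'X) z.
    by rewrite derivZ derivX hornerZ hornerC mulr1.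
  have h3 : (F - horner (K0 *: 'X)) 1 <= (F - horner (K0 *: 'X)) 2.
    apply: (derive_ge0_le le12 (df := fun z => kernel m q z - K0)) => z zb.
      have zb' : (Y * M)^-1 <= z <= Y * M.
        have /andP[z1 z2] := zb.
        by rewrite (le_trans (ltW Z1)) // (le_trans z2) // (le_trans Yge2).
      exact: (is_deriveB (dFZ z zb') (dP z)).
    by rewrite subr_ge0 kernel_ge.
  have {}h3 : F 1 - K0 * 1 <= F 2 - K0 * 2.
    have E z : K0 * z = (K0 *: 'X).[z] by rewrite hornerZ hornerX.
    by rewrite !E.
  by rewrite /D; lra.
(* moving the ends of the interval by the factor a changes the integral little *)
have close a : a \in s ++ t -> 0 < a -> `|(F (Y * a) - F (Y^-1 * a)) - D| <= err.
  move=> ain a0; have /andP[a1 a2] := HM a ain a0.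
  have Mi0 : 0 < M^-1 by rewrite invr_gt0.
  have Mi1 : M^-1 <= 1 by rewrite invf_le1.
  have Yn0 : Y != 0 by rewrite gt_eqF.
  have Mn0 : M != 0 by rewrite gt_eqF.
  have b1 : `|F (Y * a) - F Y| <= (Y / M) `^ (- (al + 1)) * (Y * M - Y / M).
    apply: (derive_bounded_dist (df := kernel m q)) => [z /andP[z1 z2]|z /andP[z1 z2]||].
    + by apply: dFZ; rewrite z2 andbT (le_trans _ z1) // invfM ler_pM2r.
    + have z0 : 0 < z by apply: lt_le_trans z1; rewrite divr_gt0.
      rewrite kernel_ge0 ?(ltW z0) //=; apply: le_trans (kernel_le _ m0 z0) _.
      have -> : m%:R - q - 1 = - (al + 1) by rewrite /al; ring.
      by apply: powRN_le => //; rewrite ?divr_gt0 // addr_ge0 // ltW.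
    + by rewrite !ler_pM2l // a1.
    + by rewrite YYM andbT ler_piMr // ltW.
  have b2 : `|F (Y^-1 * a) - F Y^-1| <= (Y * M)^-1 `^ (- al) * (Y^-1 * M - (Y * M)^-1).
    apply: (derive_bounded_dist (df := kernel m q)) => [z /andP[z1 z2]|z /andP[z1 z2]||].
    + by apply: dFZ; rewrite z1 (le_trans z2) // ler_pM2r.
    + have z0 : 0 < z by apply: lt_le_trans z1.
      rewrite kernel_ge0 ?(ltW z0) //=; apply: le_trans (kernel_leS _ _ z0) _.
      have -> : m%:R - q = - al by rewrite /al; ring.
      by apply: powRN_le => //; exact: ltW.
    + by rewrite invfM !ler_pM2l // a1.
    + by rewrite YMi ler_peMr // ltW.
  have -> : F (Y * a) - F (Y^-1 * a) - D =
    (F (Y * a) - F Y) - (F (Y^-1 * a) - F Y^-1) by rewrite /D; ring.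
  apply: le_trans (ler_normB _ _) _.
  apply: le_trans (lerD b1 b2) _.
  have e1 : (Y / M) `^ (- (al + 1)) * (Y * M) = M `^ (al + 1) * M * Y `^ (- al).
    rewrite powRM ?(ltW Y0) ?(ltW Mi0) // opprD [Y `^ _]powRD ?(gt_eqF Y0) ?implybT //.
    rewrite powR_inv1 ?(ltW Y0) // -[M^-1]powR_inv1 ?(ltW M0) // -powRrM.
    have -> : -1 * (- al - 1) = al + 1 by ring.
    by field; rewrite gt_eqF.
  have e2 : (Y * M)^-1 `^ (- al) * (Y^-1 * M) = M `^ al * M * Y `^ (- be).
    rewrite -[(Y * M)^-1]powR_inv1 ?(ltW YM0) // -powRrM mulN1r opprK.
    rewrite powRM ?(ltW Y0) ?(ltW M0) // -[Y^-1]powR_inv1 ?(ltW Y0) //.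
    have -> : - be = al + -1 by rewrite /be /al -[m.+1%:R]natr1; ring.
    by rewrite [Y `^ (al + -1)]powRD ?(gt_eqF Y0) ?implybT //; ring.
  have p1 : 0 <= (Y / M) `^ (- (al + 1)) * (Y / M).
    by rewrite mulr_ge0 ?powR_ge0 // divr_ge0 ?(ltW Y0) ?(ltW M0).
  have p2 : 0 <= (Y * M)^-1 `^ (- al) * (Y * M)^-1.
    by rewrite mulr_ge0 ?powR_ge0 // ltW.
  rewrite !mulrBr e1 e2.
  apply: le_trans (_ : _ <= M `^ (al + 1) * M * Y `^ (- al) + M `^ al * M * Y `^ (- be)) _.
    lra.
  rewrite /err /C; have := powR_ge0 Y (- al); have := powR_ge0 Y (- be).
  have := mulr_ge0 (powR_ge0 M (al + 1)) (ltW M0).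
  have := mulr_ge0 (powR_ge0 M al) (ltW M0).
  move: (M `^ (al + 1) * M) (M `^ al * M) (Y `^ (- al)) (Y `^ (- be)) => a' b' c' d'.
  move=> ha hb hc hd; rewrite -subr_ge0.
  have -> : (a' + b') * (c' + d') - (a' * c' + b' * d') = a' * d' + b' * c' by ring.
  by rewrite addr_ge0 // mulr_ge0.
have sumle r : (forall a, a \in r -> a \in s ++ t) -> all (>= 0) r -> 
    `|\sum_(a <- r) a `^ q * F (Y * a) - \sum_(a <- r) a `^ q * F (Y^-1 * a) -
      (\sum_(a <- r) a `^ q) * D| <= (\sum_(a <- r) a `^ q) * err.
  move=> rin r0; rewrite -sumrB !mulr_suml -sumrB.
  apply: le_trans (ler_norm_sum _ _ _) _.
  rewrite big_seq [X in _ <= X]big_seq; apply: ler_sum => a ain.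
  rewrite -mulrBr -mulrBr normrM (ger0_norm (powR_ge0 _ _)).
  have := allP r0 a ain; rewrite le_eqVlt => /predU1P[<-|a0].
    by rewrite powR0 ?gt_eqF // !mul0r.
  by rewrite ler_wpM2l ?powR_ge0 // close // rin.
have hs : `|\sum_(a <- s) a `^ q * F (Y * a) -
    \sum_(a <- s) a `^ q * F (Y^-1 * a) - A * D| <= A * err.
  by apply: sumle => // a ain; rewrite mem_cat ain.
have ht : `|\sum_(a <- t) a `^ q * F (Y * a) -
    \sum_(a <- t) a `^ q * F (Y^-1 * a) - B * D| <= B * err.
  by apply: sumle => // a ain; rewrite mem_cat ain orbT.
have errb : (A + B) * err < (B - A) * K0.
  have AB : 0 < A + B + 1 by rewrite ltr_wpDl // addr_ge0.
  have errle : err <= C * (e + e) by rewrite ler_pM2l // lerD.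
  have E : (A + B + 1) * (C * (e + e)) = (B - A) * K0.
    by rewrite /e; field; rewrite !gt_eqF.
  rewrite -E; apply: le_lt_trans (ler_wpM2l (addr_ge0 A0 B0) errle) _.
  by rewrite ltr_pM2r ?ltrDl // mulr_gt0 // addr_gt0.
have BAD : (B - A) * K0 <= (B - A) * D by rewrite ler_pM2l // subr_gt0.
have : (B - A) * D <= (A + B) * err; last by move/(lt_le_trans (lt_le_trans errb BAD)); rewrite ltxx.
move: mono hs ht; rewrite /Th /= !ler_norml => mono /andP[_ hs] /andP[ht _].
rewrite mulrBl mulrDl; lra.
Qed.
End Mellin.

Section PowerSumComparison.
Variable R : realType.
Implicit Types (s t : seq R).

Lemma powR_exponent_continuous (a : R) : 0 < a -> continuous (powR a).
Proof.
move=> a0 q; have -> : powR a = @expR R \o horner ((ln a) *: 'X).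
  by apply/funext => r; rewrite /= hornerZ hornerX /powR gt_eqF // mulrC.
by apply: continuous_comp; [exact: continuous_horner|exact: continuous_expR].
Qed.

Lemma power_sum_continuous s : all (> 0) s ->
  continuous (fun q => \sum_(a <- s) a `^ q).
Proof.
elim: s => [_|a s IH /=/andP[a0 s0]].
  rewrite (_ : (fun _ => _) = cst 0); last by apply/funext => r; rewrite big_nil.
  exact: cst_continuous.
rewrite (_ : (fun _ => _) = (powR a) + (fun q => \sum_(a <- s) a `^ q)).
  by move=> q; apply: continuousD; [exact: powR_exponent_continuous | exact: IH].
by apply/funext => r; rewrite big_cons.
Qed.

(** Integer exponents are limits from the right of noninteger ones, and both sides
   are continuous in the exponent as all the bases are positive. *)
Lemma power_sum_le q s t d : 1 <= q -> all (> 0) s -> all (> 0) t ->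
  alternating 1 (fun y => \sum_(b <- t) ln (1 + y * b) -
                          \sum_(a <- s) ln (1 + y * a)) d ->
  \sum_(b <- t) b `^ q <= \sum_(a <- s) a `^ q.
Proof.
move=> q1 s0 t0 ad.
have pos r : all (> 0) r -> all (>= 0) r.
  by apply: sub_all => a; exact: ltW.
have nonint r : 1 < r -> (Num.truncn r)%:R != r ->
    \sum_(b <- t) b `^ r <= \sum_(a <- s) a `^ r.
  move=> r1 rn; have r0 : 0 <= r by rewrite (le_trans ler01) // ltW.
  have /andP[h1 h2] := truncn_itv r0.
  have m0 : (0 < Num.truncn r)%N by rewrite truncn_gt0 ltW.
  apply: (@power_sum_le_noninteger _ (Num.truncn r)) => //; try exact: pos.
    by rewrite lt_neqAle rn.
  by move=> y y0; apply: (ln_tail_sum_le _ _ ad) => //; exact: pos.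
have [qn|] := eqVneq ((Num.truncn q)%:R) q; last first.
  move: q1; rewrite le_eqVlt => /predU1P[<-|q1]; last exact: nonint.
  by rewrite -[1]/(1%:R) natrK eqxx.
rewrite leNgt; apply/negP => lt.
pose g r := \sum_(b <- t) b `^ r - \sum_(a <- s) a `^ r.
have gc : {for q, continuous g}.
  apply: continuousB; exact: power_sum_continuous.
have gr : (g r @[r --> q^'+] --> g q)%classic by exact: cvg_at_right_filter gc.
have g0 : 0 < g q by rewrite subr_gt0.
have near_g := cvgr_gt _ gr _ g0.
near (q^'+)%classic => r.
have qr : q < r by near: r; exact: nbhs_right_gt.
have rq : r < q + 1 by near: r; apply: nbhs_right_lt; rewrite ltrDl.
have : 0 < g r by near: r; exact: near_g.
rewrite subr_gt0 ltNge => /negP; apply; apply: nonint.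
  exact: le_lt_trans q1 qr.
apply: contraTneq qr => rn; rewrite -leNgt -rn -qn ler_nat.
rewrite -ltnS -(ltr_nat R) rn -natr1 qn //.
Unshelve. all: by end_near.
Qed.
End PowerSumComparison.

(** * Continued fractions of paths *)

Section PathFunctions.
Variable R : realType.
Implicit Types (f g : R -> R) (c d : nat -> R) (y : R).

(** Green function at an end of the path on k vertices, see [path_green]; the
   recursion removes that end. *)
Fixpoint pfun k y : R := if k is j.+1 then (1 + y * pfun j y)^-1 else 0.

(** Number of closed walks of each even length from an end of that path. *)
Fixpoint pcoef k : nat -> R := if k is j.+1 then geom (pcoef j) else fun=> 0.

(** Half the logarithm of det (1 + y A ^ 2) for the path on k vertices, see
   [path_plog]. *)
Definition plog k y : R := \sum_(j < k) ln (1 + y * pfun j y).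

Lemma pfun_enveloped k : enveloped (pfun k) (pcoef k).
Proof. by elim: k => [|k IH]; [exact: enveloped0 | exact: enveloped_geom]. Qed.

Lemma pfun_ge0 k y : 0 < y -> 0 <= pfun k y.
Proof. by have [_ h _] := pfun_enveloped k; apply: h. Qed.

Lemma onepM_gt0 y z : 0 < y -> 0 <= z -> 0 < 1 + y * z.
Proof. by move=> y0 z0; rewrite ltr_pwDl // mulr_ge0 // ltW. Qed.

(** The Green function at an end of a path in terms of the two pieces left by an inner
   vertex; the induction extends one of the pieces. *)
Lemma pfunD a b y : 0 < y ->
  pfun (a + b).+1 y = (1 + y * (pfun a y * pfun b y)) / (1 + y * (pfun a y + pfun b y)).
Proof.
move=> y0; elim: a => [|a IH]; first by rewrite add0n /= mul0r mulr0 addr0 mul1r add0r.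
have [pa pb] := (pfun_ge0 a y0, pfun_ge0 b y0).
have n1 : 1 + y * pfun a y != 0 by rewrite gt_eqF // onepM_gt0.
have n2 : 1 + y * (pfun a y + pfun b y) != 0 by rewrite gt_eqF // onepM_gt0 // addr_ge0.
have n3 : 0 <= pfun a y * pfun b y by rewrite mulr_ge0.
have [P1 P2 P3] : [/\ 0 <= y * pfun a y, 0 <= y * pfun b y & 0 <= y * (pfun a y * pfun b y)].
  by split; rewrite mulr_ge0 // ltW.
have P4 := mulr_ge0 P1 P2.
rewrite addSn [LHS]/= -/(pfun (a + b).+1 y) IH [pfun a.+1 y]/=.
field; do ?[apply/and3P; split] => //; rewrite gt_eqF //; nra.
Qed.

Lemma plogS k y : plog k.+1 y = plog k y + ln (1 + y * pfun k y).
Proof. by rewrite /plog big_ord_recr. Qed.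

Lemma plogD a b y : 0 < y -> plog (a + b).+1 y =
  plog a y + plog b y + ln (1 + y * (pfun a y + pfun b y)).
Proof.
move=> y0; elim: a => [|a IH]; first by rewrite add0n plogS /plog big_ord0 !add0r.
have [pa pb] := (pfun_ge0 a y0, pfun_ge0 b y0).
have pq := pfun_ge0 (a + b).+1 y0; have pa1 := pfun_ge0 a.+1 y0.
rewrite addSn plogS IH plogS.
suff K : ln (1 + y * (pfun a y + pfun b y)) + ln (1 + y * pfun (a + b).+1 y) =
    ln (1 + y * pfun a y) + ln (1 + y * (pfun a.+1 y + pfun b y)).
  by rewrite -addrA K; ring.
rewrite -!lnM ?posrE ?onepM_gt0 ?addr_ge0 //; congr ln.
rewrite pfunD // [pfun a.+1 y]/=.
have n1 : 1 + y * pfun a y != 0 by rewrite gt_eqF // onepM_gt0.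
have n2 : 1 + y * (pfun a y + pfun b y) != 0 by rewrite gt_eqF // onepM_gt0 // addr_ge0.
by field; apply/andP; split.
Qed.

(** A weight s next to a branch p contributes as much as p alone followed by s seen
   through 1 / (1 + y p). *)
Lemma ln_splitD y s p : 0 < y -> 0 <= s -> 0 <= p ->
  ln (1 + y * (s + p)) = ln (1 + y * p) + ln (1 + y * ((1 + y * p)^-1 * s)).
Proof.
move=> y0 s0 p0; have n : 0 < 1 + y * p by exact: onepM_gt0.
rewrite -lnM ?posrE //; last first.
  by rewrite onepM_gt0 // mulr_ge0 // invr_ge0 ltW.
by congr ln; field; rewrite gt_eqF.
Qed.

(** [inner_fun] is the Green function at the vertex of the path on a + b + 1 vertices
   that has a vertices on one side and b on the other; [inner_coef] counts its closed
   walks. *)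
Definition inner_coef a b := geom (fun k => pcoef a k + pcoef b k).

Definition inner_fun a b y := (1 + y * (pfun a y + pfun b y))^-1.

Lemma inner_enveloped a b : enveloped (inner_fun a b) (inner_coef a b).
Proof. by apply/enveloped_geom/envelopedD; apply: pfun_enveloped. Qed.

Definition shift c k : R := if k is j.+1 then c j else 0.

Lemma alternating_shift f c : enveloped f c ->
  alternating 0 (fun y => - y * f y) (shift c).
Proof.
move=> [c0 f0 fa] [|i] y _ y0.
  rewrite alt_sum0 /= subr0 expr1 mulN1r mulNr opprK mulr_ge0 ?f0 //.
  exact: ltW.
have E : alt_sum (shift c) i.+1 y = - y * alt_sum c i y.
  by rewrite alt_sum_shift /= sub0r mulNr.
have -> : (-1) ^+ i.+2 * (- y * f y - alt_sum (shift c) i.+1 y) =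
          y * ((-1) ^+ i.+1 * (f y - alt_sum c i y)).
  by rewrite E exprS; ring.
by rewrite mulr_ge0 ?fa // ltW.
Qed.

(** By [pfunD] the two Green functions differ by exactly - y times a product of
   enveloped functions. *)
Lemma inner_end_alternating a b : exists e : nat -> R, [/\ forall k, 0 <= e k,
  forall k, inner_coef a b k - pcoef (a + b).+1 k = e k &
  alternating 0 (fun y => inner_fun a b y - pfun (a + b).+1 y) e].
Proof.
pose c := conv (conv (pcoef a) (pcoef b)) (inner_coef a b).
have ce : enveloped (fun y => pfun a y * pfun b y * inner_fun a b y) c.
  by apply: envelopedM; [apply: envelopedM; apply: pfun_enveloped
                        | exact: inner_enveloped].
have sh := alternating_shift ce.
have E y : 0 < y -> - y * (pfun a y * pfun b y * inner_fun a b y) =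
    inner_fun a b y - pfun (a + b).+1 y.
  move=> y0; rewrite pfunD // /inner_fun; field.
  by rewrite gt_eqF // onepM_gt0 // addr_ge0 // pfun_ge0.
exists (shift c); split; last exact: eq_alternating sh.
  by case=> //= k; have [c0 _ _] := ce; apply: c0.
move=> k.
have [_ _ pa] := pfun_enveloped (a + b).+1.
have [_ _ ia] := inner_enveloped a b.
have := alternatingD sh pa.
move/(eq_alternating (g := inner_fun a b)).
move=> /(_ _)/alternating_unique/(_ ia) <- => [|y y0]; last by rewrite E // subrK.
by rewrite addrK.
Qed.

Lemma pcoef_le_inner a b k : pcoef (a + b).+1 k <= inner_coef a b k.
Proof.
have [e [e0 E _]] := inner_end_alternating a b.
by rewrite -subr_ge0 E.
Qed.

(** By [plogD] both expressions are the determinant of the path on a + b + 1 vertices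
   with the weight [s] at an end and at an inner vertex respectively, so that
   [inner_end_alternating] and [ln_ratio_alternating] apply. *)
Lemma merge_alternating a b s c : enveloped s c -> exists d,
  alternating 1 (fun y =>
    (plog (a + b) y + ln (1 + y * (s y + pfun (a + b) y))) -
    (plog a y + plog b y + ln (1 + y * (s y + (pfun a y + pfun b y))))) d.
Proof.
move=> se; have [c0 s0 sa] := se; have [e [e0 E ea]] := inner_end_alternating a b.
have g1 := envelopedM (pfun_enveloped (a + b).+1) se.
have g2 := envelopedM (inner_enveloped a b) se.
have EE k : conv (inner_coef a b) c k - conv (pcoef (a + b).+1) c k = conv e c k.
  by rewrite /conv -sumrB; apply: eq_bigr => i _; rewrite -E mulrBl.
have [|| d [_ _ da]] := ln_ratio_alternating (i0 := 0) g1 g2.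
- by move=> k; rewrite -subr_ge0 EE conv_ge0.
- have := alternatingM e0 ea se => H i y ii y0; have := H i y ii y0.
  congr (0 <= _ * (_ - _)); first by rewrite mulrBl.
  by apply: eq_bigr => k _; rewrite EE.
exists d; apply: eq_alternating da => y y0.
have [pa pb] := (pfun_ge0 a y0, pfun_ge0 b y0); have sy := s0 y y0.
rewrite ln_splitD ?pfun_ge0 // [in RHS]addrA -plogS.
rewrite [in X in _ = _ - X]ln_splitD ?addr_ge0 //.
rewrite [in X in _ = _ - X]addrA -plogD //.
by rewrite opprD addrACA subrr add0r.
Qed.

End PathFunctions.

(** * Green functions of symmetric matrices *)

Section Resolvent.
Variables (R : realType) (n : nat).
Implicit Types (A : 'M[R]_n) (u v w b : 'cV[R]_n) (y : R).

Definition dot u v : R := (u^T *m v) 0 0.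

Lemma dotE u v : dot u v = \sum_i u i 0 * v i 0.
Proof. by rewrite /dot mxE; apply: eq_bigr => i _; rewrite mxE. Qed.

Lemma dotC u v : dot u v = dot v u.
Proof. by rewrite !dotE; apply: eq_bigr => i _; rewrite mulrC. Qed.

Lemma dotDr u v w : dot u (v + w) = dot u v + dot u w.
Proof. by rewrite /dot mulmxDr mxE. Qed.

Lemma dotDl u v w : dot (u + v) w = dot u w + dot v w.
Proof. by rewrite dotC dotDr !(dotC w). Qed.

Lemma dotZr a u v : dot u (a *: v) = a * dot u v.
Proof. by rewrite /dot -scalemxAr mxE. Qed.

Lemma dotZl a u v : dot (a *: u) v = a * dot u v.
Proof. by rewrite dotC dotZr dotC. Qed.

Lemma dotNr u v : dot u (- v) = - dot u v.
Proof. by rewrite /dot mulmxN mxE. Qed.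

Lemma dot0r u : dot u 0 = 0. Proof. by rewrite /dot mulmx0 mxE. Qed.

Lemma dot0l u : dot 0 u = 0. Proof. by rewrite dotC dot0r. Qed.

Lemma dot_ge0 u : 0 <= dot u u.
Proof. by rewrite dotE sumr_ge0 // => i _; rewrite -expr2 sqr_ge0. Qed.

Lemma dot_eq0 u : dot u u = 0 -> u = 0.
Proof.
rewrite dotE => /eqP; rewrite psumr_eq0 => [/allP H|i _]; last first.
  by rewrite -expr2 sqr_ge0.
apply/matrixP => i j; rewrite ord1 mxE; apply/eqP.
by have := H i (mem_index_enum _); rewrite mulf_eq0 orbb.
Qed.

Lemma dot_mulmx A u v : dot (A *m u) v = dot u (A^T *m v).
Proof. by rewrite /dot trmx_mul mulmxA. Qed.

Variable A : 'M[R]_n.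
Hypothesis Asym : A^T = A.

Lemma dot_sym u v : dot (A *m u) v = dot u (A *m v).
Proof. by rewrite dot_mulmx Asym. Qed.

(** The form of [bmx]; its Cauchy-Schwarz inequality is the source of the bounds on
   [green]. *)
Definition bform y u v := dot u v + y * dot (A *m u) (A *m v).

Lemma bformC y u v : bform y u v = bform y v u.
Proof. by rewrite /bform dotC (dotC (A *m u)). Qed.

Lemma bform_ge0 y u : 0 <= y -> 0 <= bform y u u.
Proof. by move=> y0; rewrite addr_ge0 ?dot_ge0 // mulr_ge0 ?dot_ge0. Qed.

Lemma bform_eq0 y u : 0 <= y -> bform y u u = 0 -> u = 0.
Proof.
move=> y0 /eqP; rewrite paddr_eq0 ?dot_ge0 ?mulr_ge0 ?dot_ge0 //.
by case/andP => /eqP /dot_eq0.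
Qed.

Lemma bform_cauchy y u v : 0 <= y ->
  bform y u v ^+ 2 <= bform y u u * bform y v v.
Proof.
move=> y0; have := bform_ge0 v y0; rewrite le_eqVlt => /predU1P[/esym/(bform_eq0 y0)->|v0].
  by rewrite /bform mulmx0 !dot0r mulr0 addr0 expr0n mulr0.
have := bform_ge0 (u - (bform y u v / bform y v v) *: v) y0.
set t := _ / _; have tE : t * bform y v v = bform y u v by rewrite divfK ?gt_eqF.
clearbody t.
have -> : bform y (u - t *: v) (u - t *: v) =
    bform y u u - t * bform y u v - t * bform y u v + t * (t * bform y v v).
  rewrite /bform -scaleNr !mulmxDr -!scalemxAr !(dotDl, dotDr, dotZl, dotZr).
  rewrite (dotC v u) (dotC (A *m v) (A *m u)); ring.
rewrite tE subrK subr_ge0 -(ler_pM2r v0) => H; apply: le_trans H.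
by rewrite mulrAC tE expr2.
Qed.

Definition bmx y : 'M[R]_n := 1%:M + y *: (A *m A).

Lemma bmxE y u v : dot u (bmx y *m v) = bform y u v.
Proof.
by rewrite /bmx mulmxDl mul1mx -scalemxAl dotDr dotZr -mulmxA -dot_sym.
Qed.

Lemma bmx_unit y : 0 <= y -> bmx y \in unitmx.
Proof.
move=> y0; rewrite -row_free_unit -kermx_eq0.
apply/eqP/row_matrixP => i; rewrite row0; set r := row i _.
have rB : r *m bmx y = 0 by apply/sub_kermxP; rewrite row_sub.
apply/trmx_inj; rewrite trmx0; apply: (bform_eq0 y0).
rewrite -bmxE -[bmx y]trmxK -trmx_mul.
have -> : (bmx y)^T = bmx y.
  by rewrite /bmx linearD /= trmx1 linearZ /= trmx_mul Asym.
by rewrite rB trmx0 dot0r.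
Qed.

Definition res y b := invmx (bmx y) *m b.

Lemma resK y b : 0 <= y -> bmx y *m res y b = b.
Proof. by move=> y0; rewrite /res mulmxA mulmxV ?bmx_unit // mul1mx. Qed.

Lemma res_unique y b x : 0 <= y -> bmx y *m x = b -> x = res y b.
Proof. by move=> y0 <-; rewrite /res mulKmx ?bmx_unit. Qed.

Lemma res_mulmx y b : 0 <= y -> res y (A *m b) = A *m res y b.
Proof.
move=> y0; apply/esym/res_unique => //; rewrite -{2}[b](resK b y0).
rewrite !mulmxA; congr (_ *m _).
by rewrite /bmx mulmxDl mulmxDr mul1mx mulmx1 -scalemxAl -scalemxAr mulmxA.
Qed.

Definition green y b := dot b (res y b).

Lemma greenE y b : 0 <= y -> green y b = bform y (res y b) (res y b).
Proof. by move=> y0; rewrite -bmxE resK // dotC. Qed.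

Lemma green_ge0 y b : 0 <= y -> 0 <= green y b.
Proof. by move=> y0; rewrite greenE ?bform_ge0. Qed.

(** Each use trades a factor - y for a multiplication of b by A; iterated, this is
   the expansion of [green] in powers of - y. *)
Lemma green_rec y b : 0 <= y -> green y b = dot b b - y * green y (A *m b).
Proof.
move=> y0; have -> : dot b b = bform y b (res y b) by rewrite -bmxE resK.
by rewrite /green res_mulmx // /bform addrK.
Qed.

(** Cauchy-Schwarz for [bform], between z and (1 + y A ^ 2)^-1 w. *)
Lemma green_cauchy y w z : 0 <= y -> dot w z ^+ 2 <= green y w * bform y z z.
Proof.
move=> y0; have -> : dot w z = bform y (res y w) z.
  by rewrite bformC -bmxE resK // dotC.
by rewrite greenE // bform_cauchy.
Qed.

(** For an adjacency matrix and the indicator b of a vertex, the number of closed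
   walks of length 2 k. *)
Definition moment b k := dot (iter k (mulmx A) b) (iter k (mulmx A) b).

Lemma moment_ge0 b k : 0 <= moment b k. Proof. exact: dot_ge0. Qed.

Lemma green_remainder y b i : 0 <= y ->
  green y b - alt_sum (moment b) i y =
  (- y) ^+ i.+1 * green y (iter i.+1 (mulmx A) b).
Proof.
move=> y0; elim: i => [|i IH].
  by rewrite alt_sum0 expr1 [green y b]green_rec // /moment /=; ring.
rewrite alt_sumS opprD addrA IH.
rewrite [green y (iter i.+1 _ _)]green_rec // -/(moment b i.+1).
by rewrite -[A *m iter _ _ _]/(iter i.+2 (mulmx A) b) [(- y) ^+ i.+2]exprS; ring.
Qed.

Lemma green_enveloped b : enveloped (green^~ b) (moment b).
Proof.
split; [exact: moment_ge0 | by move=> y y0; rewrite green_ge0 // ltW|].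
move=> i y _ y0; rewrite green_remainder ?(ltW y0) // mulrA -exprMn mulN1r opprK.
by rewrite mulr_ge0 ?exprn_ge0 ?green_ge0 ?(ltW y0).
Qed.

Lemma moment_cross b k : dot (iter k.+2 (mulmx A) b) (iter k (mulmx A) b) =
  moment b k.+1.
Proof. by rewrite /moment iterS dot_sym. Qed.

Lemma moment_log_convex b k :
  moment b k.+1 ^+ 2 <= moment b k * moment b k.+2.
Proof.
rewrite -moment_cross dotC; have := bform_cauchy (iter k (mulmx A) b) (iter k.+2 (mulmx A) b) (lexx 0).
by rewrite /bform !mul0r !addr0.
Qed.

(** [green_cauchy] with w = A ^ (k + 2) b and z = A ^ k b. *)
Lemma green_lower b k y : 0 <= y -> moment b k.+1 ^+ 2 <=
  green y (iter k.+2 (mulmx A) b) * (moment b k + y * moment b k.+1).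
Proof. by move=> y0; rewrite -{1}moment_cross; apply: green_cauchy. Qed.

(** [green_cauchy] with w = z = A ^ k b; the Green function of A ^ k b on the right is
   then expressed by that of A ^ (k + 1) b with [green_rec]. *)
Lemma green_upper b k y : 0 < y ->
  green y (iter k.+1 (mulmx A) b) * (moment b k + y * moment b k.+1) <=
  moment b k * moment b k.+1.
Proof.
move=> y0; have := green_cauchy (iter k (mulmx A) b) (iter k (mulmx A) b) (ltW y0).
rewrite [green _ (iter k _ _)]green_rec ?(ltW y0) // /bform -/(moment b k).
rewrite -[A *m iter k _ _]/(iter k.+1 (mulmx A) b) -/(moment b k.+1).
move: (green _ _) (moment b k) (moment b k.+1) => g m m' H.
rewrite -subr_ge0 -(pmulr_rge0 _ y0); nra.
Qed.

End Resolvent.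

(** * Deleting a vertex of a bipartite graph *)

(** Two factorizations of one block matrix into triangular ones. *)
Lemma det_rank_one (K : comNzRingType) n (v : 'cV[K]_n) (w : 'rV[K]_n) :
  \det (1%:M + v *m w) = 1 + (w *m v) 0 0.
Proof.
pose B := block_mx 1%:M (- v) w (1%:M : 'M_1).
have E1 : B = block_mx 1%:M 0 w (1%:M : 'M_1) *m
              block_mx 1%:M (- v) 0 (1%:M + w *m v).
  rewrite mulmx_block !mul1mx !mulmx1 !mulmx0 !mul0mx ?addr0 ?add0r.
  by rewrite mulmxN addrC addrK.
have E2 : B = block_mx (1%:M + v *m w) (- v) 0 (1%:M : 'M_1) *m
              block_mx 1%:M 0 w (1%:M : 'M_1).
  rewrite mulmx_block !mulmx1 !mulmx0 ?mul0mx ?mul1mx ?addr0 ?add0r.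
  by rewrite mulNmx addrK.
have := congr1 determinant E1; rewrite {1}E2 !det_mulmx.
rewrite !(det_lblock, det_ublock) !det1 !mulr1 !mul1r det_mx11 => ->.
by rewrite !mxE eqxx mulr1n.
Qed.

Section MaskedAdjacency.
Variables (R : realType) (n : nat) (e : rel 'I_n) (side : 'I_n -> bool).
Hypothesis e_sym : symmetric e.
Hypothesis e_bip : forall x y, e x y -> side x != side y.
Implicit Types (S T C b : {set 'I_n}) (u v x : 'I_n).

(** Subgraphs keep matrices of full size, with zero rows and columns outside [S], so
   that deleting vertices stays within one type. *)
Definition adjm S : 'M[R]_n := \matrix_(i, j) ([&& e i j, i \in S & j \in S])%:R.

Definition indic b : 'cV[R]_n := \col_i (i \in b)%:R.

Definition nbrs S u : {set 'I_n} := [set x in S | e u x].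

Lemma e_irr x : e x x = false.
Proof. by apply/negP => /e_bip; rewrite eqxx. Qed.

Lemma adjm_sym S : (adjm S)^T = adjm S.
Proof.
apply/matrixP => i j; rewrite !mxE e_sym; congr (_ %:R).
by rewrite [(i \in S) && _]andbC.
Qed.

Lemma adjm_indicE S b i :
  (adjm S *m indic b) i 0 = \sum_(j in b) ([&& e i j, i \in S & j \in S])%:R.
Proof.
rewrite mxE [RHS]big_mkcond; apply: eq_bigr => j _; rewrite !mxE.
by case: (j \in b); rewrite ?mulr1 ?mulr0.
Qed.

Lemma adjm_split S u : u \in S -> adjm S = adjm (S :\ u) +
  (indic [set u] *m (indic (nbrs (S :\ u) u))^T +
   indic (nbrs (S :\ u) u) *m (indic [set u])^T).
Proof.
move=> uS; apply/matrixP => i j; rewrite !mxE !big_ord1 !mxE !inE.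
have [->|iu] := eqVneq i u; have [->|ju] := eqVneq j u;
  rewrite ?e_irr /= ?uS ?andbT ?andbF ?mul1r ?mul0r ?mulr1 ?mulr0 ?addr0 ?add0r //.
- by rewrite andbC.
- by rewrite e_sym andbC.
Qed.

Lemma adjm_mulmx_out S u : u \notin S -> adjm S *m indic [set u] = 0.
Proof.
move=> uS; apply/matrixP => i j; rewrite ord1 adjm_indicE big_set1 mxE.
by rewrite (negPf uS) !andbF.
Qed.

Lemma dot_indic b b' : dot (indic b) (indic b') = #|b :&: b'|%:R.
Proof.
rewrite dotE -sum1_card natr_sum [RHS]big_mkcond; apply: eq_bigr => i _.
by rewrite !mxE inE -natrM mulnb; case: (_ && _).
Qed.

(** The diagonal matrix of these signs anticommutes with the adjacency matrix of every
   subgraph. *)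
Definition sgn i : R := if side i then 1 else -1.

Definition signmx : 'M[R]_n := diag_mx (\row_i sgn i).

Lemma sgn_sqr i : sgn i * sgn i = 1.
Proof. by rewrite /sgn; case: ifP; rewrite ?mulrNN mulr1. Qed.

Lemma signmxE m (M : 'M_(n, m)) : signmx *m M = \matrix_(i, j) (sgn i * M i j).
Proof. by rewrite /signmx mul_diag_mx; apply/matrixP => i j; rewrite !mxE. Qed.

Lemma signmx_adjm S : signmx *m adjm S = - (adjm S *m signmx).
Proof.
rewrite signmxE /signmx mul_mx_diag; apply/matrixP => i j; rewrite !mxE.
case eij : (e i j) => /=; last by rewrite mulr0 mul0r oppr0.
have := e_bip eij; rewrite /sgn.
by case: (side i); case: (side j) => //= _; ring.
Qed.

Lemma signmx_sqr : signmx *m signmx = 1%:M.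
Proof.
rewrite signmxE; apply/matrixP => i j; rewrite !mxE.
by case: eqVneq => [->|_]; rewrite ?mulr1n ?mulr0n ?mulr0 ?sgn_sqr.
Qed.

Lemma signmx_tr : signmx^T = signmx.
Proof. by rewrite /signmx tr_diag_mx. Qed.

Lemma adjm_signmx S (v : 'cV[R]_n) :
  adjm S *m (signmx *m v) = - (signmx *m (adjm S *m v)).
Proof. by rewrite !mulmxA signmx_adjm mulNmx opprK. Qed.

Lemma signmxK (v : 'cV[R]_n) : signmx *m (signmx *m v) = v.
Proof. by rewrite mulmxA signmx_sqr mul1mx. Qed.

Lemma dot_signmx (u v : 'cV[R]_n) : dot u (signmx *m v) = dot (signmx *m u) v.
Proof. by rewrite dot_mulmx signmx_tr. Qed.

Lemma signmx_indic b k : {in b, forall i, side i = k} ->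
  signmx *m indic b = (if k then 1 else -1) *: indic b.
Proof.
move=> bk; rewrite signmxE; apply/matrixP => i j; rewrite !mxE.
by case: (boolP (i \in b)) => [/bk|_]; rewrite ?mulr0 // /sgn => ->.
Qed.

Lemma signmx_adjm2 S : signmx *m (adjm S *m adjm S) =
  (adjm S *m adjm S) *m signmx.
Proof.
rewrite mulmxA signmx_adjm mulNmx -[adjm S *m signmx *m _]mulmxA signmx_adjm.
by rewrite mulmxN opprK mulmxA.
Qed.

(** The square of A preserves the two sides, and hence so does its resolvent, while A
   exchanges them. *)
Lemma dot_indic_odd S b k y : 0 <= y -> {in b, forall i, side i = k} ->
  dot (indic b) (adjm S *m res (adjm S) y (indic b)) = 0.
Proof.
move=> y0 bk; set A := adjm S; set r := res A y (indic b).
pose s : R := if k then 1 else -1.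
have s2 : s * s = 1 by rewrite /s; case: (k); rewrite ?mulrNN mulr1.
have Db : signmx *m indic b = s *: indic b by exact: signmx_indic.
have Dr : signmx *m r = s *: r.
  have rE : bmx A y *m (signmx *m r) = s *: indic b.
    rewrite -Db -{1}[indic b](resK (adjm_sym S) (indic b) y0) !mulmxA.
    congr (_ *m _); rewrite /bmx mulmxDl mulmxDr mul1mx mulmx1 -scalemxAl.
    by rewrite -scalemxAr signmx_adjm2.
  rewrite (res_unique (adjm_sym S) y0 rE) /res -scalemxAr //.
have : s * dot (indic b) (A *m r) = - (s * dot (indic b) (A *m r)).
  rewrite -[LHS]dotZl -Db dot_mulmx signmx_tr mulmxA signmx_adjm mulNmx -mulmxA Dr.
  by rewrite -scalemxAr dotNr dotZr.
move/eqP; rewrite -subr_eq0 opprK -mulr2n mulrn_eq0 /= mulf_eq0.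
by case/orP => /eqP // s0; move: s2; rewrite s0 mul0r => /eqP; rewrite eq_sym oner_eq0.
Qed.

Lemma nbrs_side S u : {in nbrs S u, forall i, side i = ~~ side u}.
Proof.
move=> i; rewrite inE => /andP[_ /e_bip].
by case: (side i); case: (side u).
Qed.

Lemma dot_nbrs_self S u : dot (indic (nbrs (S :\ u) u)) (indic [set u]) = 0.
Proof.
rewrite dot_indic (_ : _ :&: _ = set0) ?cards0 //.
by apply/setP => i; rewrite !inE; case: eqP; rewrite ?andbF.
Qed.

(** Schur complement: adding the vertex u adds rank two to the adjacency matrix, and
   the cross terms vanish by [dot_indic_odd] because the neighbours of u lie on one
   side. *)
Lemma green_vertex S u y : 0 <= y -> u \in S ->
  green (adjm S) y (indic [set u]) =
  (1 + y * green (adjm (S :\ u)) y (indic (nbrs (S :\ u) u)))^-1.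
Proof.
move=> y0 uS; set A := adjm (S :\ u); set b := indic (nbrs _ u).
set d := indic [set u]; set s := green A y b; set r := res A y b.
have As : A^T = A := adjm_sym _.
have s0 : 0 <= s by exact: green_ge0.
have n0 : 1 + y * s != 0 by rewrite gt_eqF // ltr_pwDl // mulr_ge0.
have Ad : A *m d = 0 by apply: adjm_mulmx_out; rewrite !inE eqxx.
have bd : dot b d = 0 := dot_nbrs_self S u.
have dd : dot d d = 1 by rewrite dot_indic setIid cards1.
have bAr : dot b (A *m r) = 0 := dot_indic_odd (S :\ u) y0 (@nbrs_side (S :\ u) u).
have AS (v : 'cV[R]_n) : adjm S *m v = A *m v + (dot b v *: d + dot d v *: b).
  rewrite (adjm_split uS) mulmxDl mulmxDl -!mulmxA -/A -/b -/d.
  by rewrite [b^T *m v]mx11_scalar [d^T *m v]mx11_scalar !mul_mx_scalar.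
pose x := (1 + y * s)^-1 *: (d - y *: (A *m r)).
have dAr : dot d (A *m r) = 0 by rewrite -dot_sym // Ad dot0l.
have rE : r + y *: (A *m (A *m r)) = b.
  have := resK As b y0; rewrite /bmx mulmxDl mul1mx -scalemxAl mulmxA.
  by rewrite -mulmxA.
have xE : x = res (adjm S) y d.
  apply: res_unique => //; first exact: adjm_sym.
  have ASx : adjm S *m x = (1 + y * s)^-1 *: r.
    rewrite /x -scalemxAr AS mulmxDr mulmxN -!scalemxAr Ad sub0r !dotDr -!scaleNr.
    rewrite !dotZr bAr dAr bd dd !mulr0 !addr0 scale0r add0r scale1r scaleNr.
    by congr (_ *: _); rewrite addrC -[X in X - _]rE addrK.
  rewrite /bmx mulmxDl mul1mx -scalemxAl -mulmxA ASx -scalemxAr AS.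
  rewrite -/r.
  have -> : dot d r = 0.
    have := congr1 (dot d) rE; rewrite dotDr dotZr -dot_sym // Ad dot0l mulr0.
    by rewrite addr0 => ->; rewrite dotC.
  rewrite scale0r addr0 -[dot b r]/s.
  have -> (v : 'cV[R]_n) : y *: ((1 + y * s)^-1 *: v) =
      (1 + y * s)^-1 *: (y *: v) by rewrite !scalerA mulrC.
  rewrite /x -scalerDr.
  rewrite [y *: (_ + _)]scalerDr addrA subrK scalerA -[X in _ *: (X + _)]scale1r.
  by rewrite -scalerDl scalerA mulVf ?scale1r.
rewrite /green -xE /x dotZr dotDr -scaleNr dotZr dAr mulr0 addr0 dd mulr1 //.
Qed.

Definition fdet S y : R := \det (bmx (adjm S) y).

(** With D the matrix of signs and Z := 1 + sqrt y D A one has Z Z^T = 1 + y A ^ 2.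
   The vertex u changes Z by two rank-one factors, one of determinant 1 and the other
   of determinant 1 + y green. *)
Lemma fdet_vertex S u y : 0 <= y -> u \in S -> fdet S y =
  fdet (S :\ u) y * (1 + y * green (adjm (S :\ u)) y (indic (nbrs (S :\ u) u))) ^+ 2.
Proof.
move=> y0 uS; set A := adjm (S :\ u); set b := indic (nbrs _ u).
set d := indic [set u]; set s := green A y b; set r := res A y b.
pose x := Num.sqrt y; have xx : x * x = y by rewrite -expr2 sqr_sqrtr.
pose Z T := 1%:M + x *: (signmx *m adjm T).
have ZZ T : (\det (Z T)) ^+ 2 = fdet T y.
  rewrite expr2 -{2}det_tr -det_mulmx /fdet; congr (\det _).
  rewrite /Z linearD /= trmx1 linearZ /= trmx_mul adjm_sym signmx_tr.
  have -> : adjm T *m signmx = - (signmx *m adjm T) by rewrite signmx_adjm opprK.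
  rewrite scalerN mulmxBr mulmx1 mulmxDl mul1mx -scalemxAl -scalemxAr scalerA xx.
  rewrite -[signmx *m adjm T *m _]mulmxA [adjm T *m (signmx *m _)]mulmxA.
  have -> : adjm T *m signmx = - (signmx *m adjm T) by rewrite signmx_adjm opprK.
  rewrite mulNmx mulmxN !mulmxA signmx_sqr mul1mx scalerN.
  by rewrite opprD opprK addrA addrK.
rewrite -!ZZ -exprMn; congr (_ ^+ 2).
have As : A^T = A := adjm_sym _.
have Ad : A *m d = 0 by apply: adjm_mulmx_out; rewrite !inE eqxx.
have bd : dot b d = 0 := dot_nbrs_self S u.
have dd : dot d d = 1 by rewrite dot_indic setIid cards1.
have bAr : dot b (A *m r) = 0 := dot_indic_odd (S :\ u) y0 (@nbrs_side (S :\ u) u).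
pose ep : R := if side u then 1 else -1.
have Dd : signmx *m d = ep *: d.
  by apply: signmx_indic => i; rewrite inE => /eqP ->.
have Db : signmx *m b = - ep *: b.
  rewrite (@signmx_indic _ (~~ side u)) /ep; last exact: nbrs_side.
  by case: (side u); rewrite ?opprK.
pose c := r - x *: (signmx *m (A *m r)).
have rE : r + y *: (A *m (A *m r)) = b.
  have := resK As b y0; rewrite /bmx mulmxDl mul1mx -scalemxAl mulmxA.
  by rewrite -mulmxA.
have dAv (v : 'cV[R]_n) : dot d (A *m v) = 0 by rewrite -dot_sym // Ad dot0l.
have dr : dot d r = 0.
  have := congr1 (dot d) rE; rewrite dotDr dotZr dAv mulr0 addr0 => ->.
  by rewrite dotC.
have Zc : Z (S :\ u) *m c = b.
  rewrite /Z /c mulmxDl mul1mx -scalemxAl -mulmxA mulmxBr -scalemxAr adjm_signmx.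
  rewrite scalerN opprK mulmxDr -scalemxAr signmxK scalerDr scalerA xx addrA subrK.
  exact: rE.
have Zd : Z (S :\ u) *m d = d.
  by rewrite /Z mulmxDl mul1mx -scalemxAl -mulmxA Ad mulmx0 scaler0 addr0.
have bc : dot b c = s.
  rewrite /c dotDr dotNr dotZr dot_signmx Db dotZl bAr !mulr0 subr0 //.
have dc : dot d c = 0.
  by rewrite /c dotDr dotNr dotZr dot_signmx Dd dotZl dAv !mulr0 subr0.
pose a := x * ep; have aa : a * a = y.
  by rewrite /a mulrACA xx /ep; case: (side u); rewrite ?mulrNN !mulr1.
pose w := (y * s) *: d - a *: c.
have bw : b^T *m w = (- a * s)%:M.
  rewrite [LHS]mx11_scalar -/(dot b w) /w dotDr dotNr !dotZr bd bc mulr0 sub0r.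
  by rewrite mulNr.
have ZS : Z S = Z (S :\ u) *m ((1%:M + (a *: d) *m b^T) *m (1%:M + w *m d^T)).
  have -> : (1%:M + (a *: d) *m b^T) *m (1%:M + w *m d^T) =
      1%:M - a *: (c *m d^T) + a *: (d *m b^T).
    rewrite mulmxDl mul1mx mulmxDr mulmx1 -mulmxA [b^T *m (w *m _)]mulmxA bw.
    rewrite mul_scalar_mx -scalemxAr -!scalemxAl scalerA mulmxBl -!scalemxAl.
    have -> : - a * s * a = - (y * s) by rewrite -aa; ring.
    rewrite scaleNr; set P := _ *: (d *m d^T); set Q := a *: _; set W := a *: _.
    by rewrite -!addrA; congr (_ + _); rewrite [P + _]addrC -!addrA addNr addr0.
  rewrite !mulmxDr mulmxN mulmx1 -!scalemxAr !mulmxA Zc Zd.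
  rewrite {1}/Z (adjm_split uS) -/A -/b -/d !mulmxDr !mulmxA Dd Db -!scalemxAl.
  rewrite !scalerDr !scalerA mulrN -/a scaleNr /Z -/A -!addrA.
  by congr (_ + (_ + _)); rewrite addrC.
rewrite ZS !det_mulmx !det_rank_one.
have E1 : (b^T *m (a *: d)) 0 0 = 0 by rewrite -/(dot b (a *: d)) dotZr bd mulr0.
have E2 : (d^T *m w) 0 0 = y * s.
  by rewrite -/(dot d w) /w dotDr dotNr !dotZr dd dc mulr0 subr0 mulr1.
by rewrite E1 E2 addr0 mul1r.
Qed.

End MaskedAdjacency.

(** * Disjoint unions *)

Section OrthogonalSums.
Variables (R : realType) (n : nat).
Implicit Types (A : 'M[R]_n) (b : 'cV[R]_n) (y : R).

(** Since A1 A2 = A2 A1 = 0, the square of A1 + A2 has no cross terms. *)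
Lemma bmx_orthogonal A1 A2 y : A1 *m A2 = 0 -> A2 *m A1 = 0 ->
  bmx (A1 + A2) y = bmx A1 y *m bmx A2 y.
Proof.
move=> A12 A21; rewrite /bmx !mulmxDl !mulmxDr A12 A21 addr0 add0r !mul1mx mulmx1.
rewrite -!scalemxAl -!scalemxAr -mulmxA [A1 *m (A2 *m A2)]mulmxA A12 mul0mx.
by rewrite mulmx0 !scaler0 addr0 scalerDr addrA addrAC.
Qed.

Lemma green_orthogonal A1 A2 b1 b2 y : 0 <= y -> A1^T = A1 -> A2^T = A2 ->
  A1 *m A2 = 0 -> A2 *m A1 = 0 -> A2 *m b1 = 0 -> A1 *m b2 = 0 ->
  dot b1 b2 = 0 ->
  green (A1 + A2) y (b1 + b2) = green A1 y b1 + green A2 y b2.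
Proof.
move=> y0 s1 s2 A12 A21 A2b A1b b12.
have s12 : (A1 + A2)^T = A1 + A2 by rewrite linearD /= s1 s2.
have kill (B1 B2 : 'M[R]_n) (b : 'cV[R]_n) : B1^T = B1 -> B2 *m B1 = 0 ->
    B2 *m b = 0 -> B2 *m res B1 y b = 0.
  move=> sB B21 Bb; have := congr1 (mulmx B2) (resK sB b y0).
  rewrite Bb /bmx mulmxDl mul1mx -scalemxAl mulmxDr -scalemxAr !mulmxA B21.
  by rewrite !mul0mx scaler0 addr0.
have k1 := kill A1 A2 b1 s1 A21 A2b; have k2 := kill A2 A1 b2 s2 A12 A1b.
have rE : res A1 y b1 + res A2 y b2 = res (A1 + A2) y (b1 + b2).
  apply: res_unique => //; rewrite bmx_orthogonal // mulmxDr -!mulmxA.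
  rewrite [bmx A2 y *m res A2 y b2]resK //.
  rewrite {1}[bmx A2 y]/bmx mulmxDl mul1mx -scalemxAl -mulmxA k1 mulmx0 scaler0.
  rewrite addr0 resK //; congr (_ + _).
  by rewrite /bmx mulmxDl mul1mx -scalemxAl -mulmxA A1b mulmx0 scaler0 addr0.
have crossz (B1 B2 : 'M[R]_n) (b b' : 'cV[R]_n) : B1^T = B1 -> B1 *m b' = 0 ->
    dot b' b = 0 -> dot b' (res B1 y b) = 0.
  move=> sB Bb' bb'; have := congr1 (dot b') (resK sB b y0).
  rewrite /bmx mulmxDl mul1mx -scalemxAl dotDr dotZr -mulmxA -dot_sym // Bb'.
  by rewrite dot0l mulr0 addr0 bb'.
rewrite /green -rE !(dotDl, dotDr) (crossz A1 A2 b1 b2) // 1?dotC //.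
by rewrite (crossz A2 A1 b2 b1) // add0r addr0.
Qed.

End OrthogonalSums.

Section NonnegativeMoments.
Variables (R : realType) (n : nat) (A : 'M[R]_n).
Hypothesis A0 : forall i j, 0 <= A i j.
Implicit Types (u v b : 'cV[R]_n).

Definition nneg u := forall i, 0 <= u i 0.

Lemma nneg_iter u k : nneg u -> nneg (iter k (mulmx A) u).
Proof.
move=> u0; elim: k => //= k IH i; rewrite mxE sumr_ge0 // => j _.
by rewrite mulr_ge0.
Qed.

Lemma moment_superadditive u v k : nneg u -> nneg v ->
  moment A u k + moment A v k <= moment A (u + v) k.
Proof.
move=> u0 v0; have iterD : iter k (mulmx A) (u + v) =
    iter k (mulmx A) u + iter k (mulmx A) v.
  by elim: k => //= k ->; rewrite mulmxDr.
have : 0 <= dot (iter k (mulmx A) u) (iter k (mulmx A) v).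
  by rewrite dotE sumr_ge0 // => i _; rewrite mulr_ge0 ?nneg_iter.
rewrite /moment iterD !(dotDl, dotDr) [dot (iter k _ v) (iter k _ u)]dotC; lra.
Qed.

End NonnegativeMoments.

Section MaskedUnion.
Variables (R : realType) (n : nat) (e : rel 'I_n).
Hypothesis e_sym : symmetric e.
Implicit Types (S T C b : {set 'I_n}) (u v x : 'I_n) (y : R).

Local Notation adj := (adjm R e).

Lemma adjm_setU C T : [disjoint C & T] ->
  (forall x z, x \in C -> z \in T -> ~~ e x z) ->
  adj (C :|: T) = adj C + adj T.
Proof.
move=> dCT noe; apply/matrixP => i j; rewrite !mxE !inE.
have noe' x (z : 'I_n) : x \in T -> z \in C -> ~~ e x z by move=> *; rewrite e_sym noe.
have dj x : x \in C -> (x \in T) = false by move=> xC; apply: (disjointFr dCT).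
case: (boolP (e i j)) => [eij|_]; last by rewrite addr0.
case iC: (i \in C); case jC: (j \in C) => /=; rewrite ?(dj _ iC) ?(dj _ jC) ?addr0 ?andbF ?andbT //=.
- by case jT: (j \in T); rewrite ?addr0 //; move: (noe _ _ iC jT); rewrite eij.
- by case iT: (i \in T); rewrite ?addr0 //; move: (noe' _ _ iT jC); rewrite eij.
- by rewrite add0r.
Qed.

Lemma adjm_mul_disjoint C T : [disjoint C & T] -> adj C *m adj T = 0.
Proof.
move=> dCT; apply/matrixP => i j; rewrite !mxE big1 // => k _; rewrite !mxE.
by case kC: (k \in C); rewrite ?(disjointFr dCT kC) ?andbF ?mulr0 ?mul0r.
Qed.

Lemma adjm_mul_indic_disjoint C b : [disjoint C & b] -> adj C *m indic R b = 0.
Proof.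
move=> dCb; apply/matrixP => i j; rewrite ord1 adjm_indicE big1 ?mxE // => k kb.
by rewrite (disjointFl dCb kb) !andbF.
Qed.

Lemma fdet_setU C T y : [disjoint C & T] ->
  (forall x z, x \in C -> z \in T -> ~~ e x z) ->
  fdet e (C :|: T) y = fdet e C y * fdet e T y.
Proof.
move=> dCT noe; rewrite /fdet adjm_setU // bmx_orthogonal ?det_mulmx //.
  exact: adjm_mul_disjoint.
by apply: adjm_mul_disjoint; rewrite disjoint_sym.
Qed.

Lemma indic_setU b b' : [disjoint b & b'] ->
  indic R (b :|: b') = indic R b + indic R b'.
Proof.
move=> d; apply/matrixP => i j; rewrite !mxE inE -natrD.
by case ib: (i \in b); rewrite ?(disjointFr d ib).
Qed.

Lemma green_setU C T b b' y : 0 <= y -> [disjoint C & T] ->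
  (forall x z, x \in C -> z \in T -> ~~ e x z) ->
  b \subset C -> b' \subset T ->
  green (adj (C :|: T)) y (indic R (b :|: b')) =
  green (adj C) y (indic R b) + green (adj T) y (indic R b').
Proof.
move=> y0 dCT noe bC bT.
have dTb : [disjoint T & b] by rewrite disjoint_sym; apply: disjointWl dCT.
have dCb : [disjoint C & b'] by apply: disjointWr dCT.
have dbb : [disjoint b & b'] by apply: disjointWl dCb.
rewrite adjm_setU // indic_setU //.
apply: green_orthogonal => //; try exact: adjm_sym.
- exact: adjm_mul_disjoint.
- by apply: adjm_mul_disjoint; rewrite disjoint_sym.
- exact: adjm_mul_indic_disjoint.
- exact: adjm_mul_indic_disjoint.
- by rewrite dot_indic (disjoint_setI0 dbb) cards0.
Qed.

Lemma adjm_ge0 S i j : 0 <= adj S i j.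
Proof. by rewrite mxE ler0n. Qed.

Lemma indic_nneg b : nneg (indic R b).
Proof. by move=> i; rewrite mxE ler0n. Qed.

Lemma moment_indic_ge S b v k : v \in b ->
  moment (adj S) (indic R [set v]) k <= moment (adj S) (indic R b) k.
Proof.
move=> vb; have -> : indic R b = indic R [set v] + indic R (b :\ v).
  by rewrite -indic_setU ?setD1K // disjoints1 !inE eqxx.
apply: le_trans (moment_superadditive _ _ _ _); rewrite ?lerDl ?moment_ge0 //.
- exact: adjm_ge0.
- exact: indic_nneg.
- exact: indic_nneg.
Qed.

Lemma moment_indic_ge2 S b u v k : u \in b -> v \in b -> u != v ->
  moment (adj S) (indic R [set u]) k + moment (adj S) (indic R [set v]) k <=
  moment (adj S) (indic R b) k.
Proof.
move=> ub vb uv; have -> : indic R b = indic R [set u] + indic R (b :\ u).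
  by rewrite -indic_setU ?setD1K // disjoints1 !inE eqxx.
apply: le_trans (moment_superadditive _ _ _ _); rewrite ?lerD2l.
- by apply: moment_indic_ge; rewrite !inE eq_sym uv.
- exact: adjm_ge0.
- exact: indic_nneg.
- exact: indic_nneg.
Qed.

End MaskedUnion.

(** * Connected sets *)
Section Connectivity.
Variables (n : nat) (e : rel 'I_n).
Hypothesis e_sym : symmetric e.
Implicit Types (S T C : {set 'I_n}) (u v x : 'I_n).

Definition erel S : rel 'I_n := [rel x y | [&& e x y, x \in S & y \in S]].

Definition gconnected S := forall x y, x \in S -> y \in S -> connect (erel S) x y.

Lemma erel_connect_sym S : connect_sym (erel S).
Proof.
apply: sym_connect_sym => x y; rewrite /erel /=.
by rewrite e_sym [(x \in S) && _]andbC.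
Qed.

Lemma connect_invariant (T : finType) (r : rel T) (P : T -> Prop) (x y : T) :
  (forall a b, r a b -> P a -> P b) -> connect r x y -> P x -> P y.
Proof.
move=> inv /connectP[p + ->]; elim: p x => //= a p IH x /andP[ra pa] Px.
by apply: IH pa _; apply: inv Px.
Qed.

Lemma connected_from S u : u \in S ->
  (forall x, x \in S -> connect (erel S) u x) -> gconnected S.
Proof.
move=> uS H x y xS yS; apply: connect_trans (H y yS).
by rewrite erel_connect_sym H.
Qed.

Lemma connected_neighbor S x : gconnected S -> x \in S -> (1 < #|S|)%N ->
  exists2 t, t \in S & e x t.
Proof.
move=> cS xS S1; have /card_gt0P[z] : (0 < #|S :\ x|)%N.
  by move: S1; rewrite (cardsD1 x) xS.
rewrite !inE => /andP[zx zS].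
have /connectP[[|t p] /=] := cS x z xS zS; first by move=> _ E; rewrite E eqxx in zx.
by move=> /andP[/and3P[xt _ tS] _] _; exists t.
Qed.

(** C is the component of a neighbour of u in [S :\ u].  A path in S from u can leave C
   only through u, so it reaches every vertex outside C without meeting C. *)
Lemma peel_component S u : irreflexive e ->
  gconnected S -> u \in S -> (1 < #|S|)%N ->
  exists C, [/\ C \subset S :\ u, gconnected C, exists2 v, v \in C & e u v,
    gconnected (S :\: C) &
    forall x y, x \in C -> y \in S :\: C :\ u -> ~~ e x y].
Proof.
move=> irr cS uS S1; have [v vS uv] := connected_neighbor cS uS S1.
have vu : v != u by apply: contraTneq uv => ->; rewrite irr.
pose C := [set x | connect (erel (S :\ u)) v x].
have CS x : x \in C -> x \in S :\ u.
  rewrite inE => vx; apply: (connect_invariant (P := fun z => z \in S :\ u) _ vx).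
    by move=> a b /and3P[].
  by rewrite !inE vu.
have vC : v \in C by rewrite inE connect0.
have Cstep a b : a \in C -> b \in S :\ u -> e a b -> b \in C.
  move=> aC bS ab; move: (aC); rewrite !inE => va; apply: connect_trans va _.
  by apply: connect1; rewrite /erel /= ab bS CS.
have uC : u \notin C by apply/negP => /CS; rewrite !inE eqxx.
exists C; split.
- by apply/fintype.subsetP.
- apply: (connected_from vC) => x; rewrite inE => vx.
  have [] // : x \in C /\ connect (erel C) v x.
  apply: (connect_invariant (P := fun z => z \in C /\ connect (erel C) v z) _ vx);
    last by split; rewrite ?connect0.
  move=> a b /and3P[ab aS bS] [aC va]; have bC := Cstep a b aC bS ab.
  by split=> //; apply: connect_trans va (connect1 _); rewrite /erel /= ab aC.
- by exists v.
- have uSC : u \in S :\: C by rewrite inE uC.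
  apply: (connected_from uSC) => x; rewrite inE => /andP[xC xS].
  have [xC'|[]//] : x \in C \/ x \in S :\: C /\ connect (erel (S :\: C)) u x.
    pose P z := z \in C \/ z \in S :\: C /\ connect (erel (S :\: C)) u z.
    apply: (connect_invariant (P := P) _ (cS u x uS xS)); rewrite /P;
      last by right; rewrite connect0.
    move=> a b /and3P[ab aS bS] Pa.
    have [bC|bC] := boolP (b \in C); [by left | right].
    have bSC : b \in S :\: C by rewrite inE bC.
    split=> //; case: Pa => [aC|[aSC ua]].
      have [-> //|bu] := eqVneq b u.
      by case/negP: bC; apply: Cstep ab => //; rewrite !inE bu.
    by apply: connect_trans ua (connect1 _); rewrite /erel /= ab aSC.
  by rewrite xC' in xC.
- move=> x y xC; rewrite !inE => /and3P[yu yC yS]; apply: contra yC => xy.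
  by have := Cstep x y xC _ xy; rewrite !inE yu yS => ->.
Qed.

End Connectivity.

(** * Closed walks *)

Section WalkComparison.
Variable R : realType.
Implicit Types c d g : nat -> R.

Lemma conv_le c c' d d' : (forall k, 0 <= c k) -> (forall k, c k <= c' k) ->
  (forall k, 0 <= d k) -> (forall k, d k <= d' k) ->
  forall k, conv c d k <= conv c' d' k.
Proof. by move=> c0 cc d0 dd k; apply: ler_sum => i _; apply: ler_pM. Qed.

Lemma geom_le c c' : (forall k, 0 <= c k) -> (forall k, c k <= c' k) ->
  forall k, geom c k <= geom c' k.
Proof.
move=> c0 cc; elim/ltn_ind => -[|k] IH; first by rewrite !geom0.
rewrite !geomS; apply: ler_sum => i _; apply: ler_pM => //.
- exact: geom_ge0.
- by rewrite IH // ltnS leq_subr.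
Qed.

Lemma pcoef_ge0 n k : 0 <= pcoef R n k.
Proof. by have [] := pfun_enveloped R n. Qed.

(** The b vertices on one side hang at the end of the path formed by the others. *)
Lemma inner_fun_split a b (y : R) : 0 < y ->
  inner_fun a b y = pfun a.+1 y * (1 + y * (pfun b y * pfun a.+1 y))^-1.
Proof.
move=> y0; have [pa pb] := (pfun_ge0 a y0, pfun_ge0 b y0).
have n1 : 1 + y * pfun a y != 0 by rewrite gt_eqF // onepM_gt0.
have n2 : 1 + y * (pfun a y + pfun b y) != 0 by rewrite gt_eqF // onepM_gt0 // addr_ge0.
by rewrite /inner_fun /=; field; rewrite n1 -addrA -mulrDr n2.
Qed.

Variables (n : nat) (e : rel 'I_n) (side : 'I_n -> bool).
Hypothesis e_sym : symmetric e.
Hypothesis e_bip : forall x y, e x y -> side x != side y.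
Implicit Types (S T C b : {set 'I_n}) (u v x z : 'I_n) (y : R).

Local Notation adj := (adjm R e).
Local Notation ind := (indic R).

(** Self-energy of u: the only quantity through which the rest of the set enters the
   formulas of [green_vertex] and [fdet_vertex]. *)
Definition branch S u y : R := green (adj (S :\ u)) y (ind (nbrs e (S :\ u) u)).

Lemma branch_ge0 S u y : 0 <= y -> 0 <= branch S u y.
Proof. by move=> y0; apply: green_ge0; rewrite ?adjm_sym. Qed.

Lemma green_branch S u y : 0 <= y -> u \in S ->
  green (adj S) y (ind [set u]) = (1 + y * branch S u y)^-1.
Proof. exact: (green_vertex e_sym e_bip). Qed.

Lemma fdet_branch S u y : 0 <= y -> u \in S ->
  fdet e S y = fdet e (S :\ u) y * (1 + y * branch S u y) ^+ 2.
Proof. exact: (fdet_vertex e_sym e_bip). Qed.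

Section Peeling.
Variables (S C : {set 'I_n}) (u : 'I_n).
Hypotheses (uS : u \in S) (CS : C \subset S :\ u).
Hypothesis noe : forall x z, x \in C -> z \in S :\: C :\ u -> ~~ e x z.

Lemma peel_setD1 : S :\ u = C :|: (S :\: C :\ u).
Proof.
apply/setP => x; rewrite !inE; have := fintype.subsetP CS x; rewrite !inE.
by case: (x \in C) => [/(_ isT)/andP[-> ->]|_]; rewrite ?andbF.
Qed.

Lemma peel_disjoint : [disjoint C & S :\: C :\ u].
Proof.
rewrite -setI_eq0; apply/eqP/setP => x; rewrite !inE.
by case: (x \in C); rewrite ?andbF.
Qed.

Lemma peel_mem : u \in S :\: C.
Proof.
by rewrite !inE uS andbT; apply/negP => /(fintype.subsetP CS); rewrite !inE eqxx.
Qed.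

Lemma peel_branch y : 0 <= y ->
  branch S u y = green (adj C) y (ind (nbrs e C u)) + branch (S :\: C) u y.
Proof.
move=> y0; rewrite /branch peel_setD1.
have -> : nbrs e (C :|: (S :\: C :\ u)) u =
    nbrs e C u :|: nbrs e (S :\: C :\ u) u.
  by apply/setP => x; rewrite !inE -andb_orl.
apply: green_setU => //; first exact: peel_disjoint.
- by apply/fintype.subsetP => x; rewrite inE => /andP[].
- by apply/fintype.subsetP => x; rewrite inE => /andP[].
Qed.

Lemma peel_fdet y : fdet e (S :\ u) y = fdet e C y * fdet e (S :\: C :\ u) y.
Proof. by rewrite peel_setD1 fdet_setU //; apply: peel_disjoint. Qed.

Lemma peel_card : #|S| = (#|S :\: C :\ u| + #|C|).+1.
Proof.
by rewrite (cardsD1 u S) uS peel_setD1 cardsU (disjoint_setI0 peel_disjoint)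
  cards0 subn0 addnC addn1 addnC.
Qed.

End Peeling.

Lemma moment_set1 S u : moment (adj S) (ind [set u]) 0 = 1.
Proof. by rewrite /moment /= dot_indic setIid cards1. Qed.

(** Peel a component C off at u.  The expansion of the Green function at u is an
   increasing function, coefficient by coefficient, of the moments of C at the
   neighbours of u and of those of [S :\: C] at u (E1).  Both are at least those of
   the ends of paths of the same sizes, by induction; for such paths the same formula
   describes an inner vertex of a path on #|S| vertices (E2), which has at least as
   many closed walks as an end by [pcoef_le_inner]. *)
Lemma pcoef_le_moment S u k : gconnected e S -> u \in S ->
  pcoef R #|S| k <= moment (adj S) (ind [set u]) k.
Proof.
move: {2}#|S|.+1 (ltnSn #|S|) => N; elim: N S u k => // N IH S u k SN cS uS.
have irr : irreflexive e by move=> x; apply: (e_irr e_bip).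
have [S1|S1] := leqP #|S| 1.
  have -> : #|S| = 1%N by apply/eqP; rewrite eqn_leq S1; apply/card_gt0P; exists u.
  case: k => [|k]; first by rewrite moment_set1 /= geom0.
  by rewrite /= geomS /conv big1 ?moment_ge0 // => i _; rewrite mul0r.
have [C [CS cC [v vC uv] cS' noe]] := peel_component e_sym irr cS uS S1.
have cardE := peel_card uS CS; set a := #|S :\: C :\ u| in cardE.
have uS' := peel_mem uS CS.
have aE : #|S :\: C| = a.+1 by rewrite (cardsD1 u) uS' add1n.
have C0 : (0 < #|C|)%N by apply/card_gt0P; exists v.
set mC := moment (adj C) (ind (nbrs e C u)).
set m' := moment (adj (S :\: C)) (ind [set u]).
have vb : v \in nbrs e C u by rewrite inE vC.
have mC_ge j : pcoef R #|C| j <= mC j.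
  apply: le_trans (IH C v j _ cC vC) _; last exact: moment_indic_ge.
  by move: SN; rewrite cardE ltnS; apply: leq_ltn_trans; apply: leq_addl.
have m'_ge j : pcoef R a.+1 j <= m' j.
  rewrite -aE; apply: IH => //.
  move: SN; rewrite cardE aE ltnS; apply: leq_ltn_trans.
  by rewrite -addn1 leq_add2l.
have gC := green_enveloped (adjm_sym R e_sym C) (ind (nbrs e C u)).
have g' := green_enveloped (adjm_sym R e_sym (S :\: C)) (ind [set u]).
have [_ _ gS] := green_enveloped (adjm_sym R e_sym S) (ind [set u]).
have E1 : forall j, conv m' (geom (conv mC m')) j = moment (adj S) (ind [set u]) j.
  apply: alternating_unique gS.
  have [_ _] := envelopedM g' (enveloped_geom (envelopedM gC g')).
  apply: eq_alternating => y y0; have y0' := ltW y0.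
  rewrite !green_branch // (peel_branch CS noe y0').
  have [h1 h2] : 0 <= branch (S :\: C) u y /\ 0 <= green (adj C) y (ind (nbrs e C u)).
    by split; rewrite ?branch_ge0 // green_ge0 ?adjm_sym.
  have n1 : 1 + y * branch (S :\: C) u y != 0 by rewrite gt_eqF // onepM_gt0.
  have n2 : 1 + y * (green (adj C) y (ind (nbrs e C u)) + branch (S :\: C) u y) != 0.
    by rewrite gt_eqF // onepM_gt0 // addr_ge0.
  by field; rewrite n1 n2.
have E2 : forall j, conv (pcoef R a.+1) (geom (conv (pcoef R #|C|) (pcoef R a.+1))) j
    = inner_coef R a #|C| j.
  have [_ _ gI] := inner_enveloped R a #|C|; apply: alternating_unique gI.
  have pa := pfun_enveloped R a.+1.
  have [_ _] := envelopedM pa (enveloped_geom (envelopedM (pfun_enveloped R #|C|) pa)).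
  by apply: eq_alternating => y y0; rewrite inner_fun_split.
have p0 := pcoef_ge0; rewrite cardE; apply: le_trans (pcoef_le_inner _ _ _ _) _.
rewrite -E1 -E2; apply: conv_le => //.
- by apply: geom_ge0; apply: conv_ge0.
- by apply: geom_le; [apply: conv_ge0 | apply: conv_le].
Qed.

End WalkComparison.

(** * The path graph *)

Section RowSums.
Variables (R : realType) (n : nat) (A : 'M[R]_n) (D : R).
Hypotheses (Asym : A^T = A) (A0 : forall i j, 0 <= A i j).
Hypotheses (D0 : 0 < D) (AD : forall i, \sum_j A i j <= D).

(** Cauchy-Schwarz with the row i of A as weights, via the nonnegativity of the weighted
   sum of the squares of D v_j - (A v)_i. *)
Lemma row_cauchy (v : 'cV[R]_n) i :
  (A *m v) i 0 ^+ 2 <= D * \sum_j A i j * v j 0 ^+ 2.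
Proof.
rewrite mxE; have [s sE] : {s | \sum_j A i j * v j 0 = s} by eexists.
rewrite sE.
have : 0 <= \sum_j A i j * (D * v j 0 - s) ^+ 2.
  by apply: sumr_ge0 => j _; rewrite mulr_ge0 ?sqr_ge0.
have -> : \sum_j A i j * (D * v j 0 - s) ^+ 2 =
    D ^+ 2 * (\sum_j A i j * v j 0 ^+ 2) - 2 * D * s * (\sum_j A i j * v j 0) +
    s ^+ 2 * \sum_j A i j.
  rewrite !mulr_sumr -sumrB -big_split; apply: eq_bigr => j _ /=.
  ring.
rewrite sE; have := AD i; set t := \sum_j A i j; set q := \sum_j _ * _ ^+ 2 => tD H.
have H2 : s ^+ 2 * t <= s ^+ 2 * D by rewrite ler_wpM2l ?sqr_ge0.
rewrite -(ler_pM2l D0); nra.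
Qed.

(** Schur test: A has operator norm at most D. *)
Lemma moment_growth b k : moment A b k.+1 <= D ^+ 2 * moment A b k.
Proof.
rewrite /moment iterS; move: (iter k _ b) => v; rewrite !dotE.
apply: (@le_trans _ _ (\sum_i D * \sum_j A i j * v j 0 ^+ 2)).
  by apply: ler_sum => i _; rewrite -expr2 row_cauchy.
rewrite -mulr_sumr exchange_big /= expr2 -mulrA ler_pM2l // mulr_sumr.
apply: ler_sum => j _; rewrite -mulr_suml expr2 ler_wpM2r //.
  by rewrite -expr2 sqr_ge0.
rewrite (eq_bigr (fun i => A j i)) // => i _.
by rewrite -{1}Asym mxE.
Qed.

End RowSums.

Section PathRealization.
Variables (R : realType) (n : nat).
Implicit Types (y : R) (i j : 'I_n).

Local Notation e := (@path_edge n).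
Local Notation adj := (adjm R e).
Local Notation ind := (indic R).

Lemma path_edge_bip i j : path_edge i j -> odd i != odd j.
Proof.
by rewrite /path_edge /= => /orP[] /eqP <- /=; [|rewrite eq_sym]; case: (odd _).
Qed.

Definition path_set k : {set 'I_n} := [set i : 'I_n | (i < k)%N].

Lemma path_setD1 k (kn : (k < n)%N) : path_set k.+1 :\ Ordinal kn = path_set k.
Proof. by apply/setP => i; rewrite !inE -val_eqE /= ltnS -ltn_neqAle. Qed.

Lemma path_set_mem k (kn : (k < n)%N) : Ordinal kn \in path_set k.+1.
Proof. by rewrite inE /=. Qed.

Lemma path_branch k (kn : (k < n)%N) y : 0 < y ->
  branch e (path_set k.+1) (Ordinal kn) y = pfun k y.
Proof.
move=> y0; have y0' := ltW y0.
elim: k kn => [|k IH] kn; rewrite /branch path_setD1.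
  have -> : nbrs e (path_set 0) (Ordinal kn) = set0.
    by apply/setP => i; rewrite !inE ltn0.
  rewrite /green (_ : ind set0 = 0) ?dot0l //.
  by apply/matrixP => i j; rewrite !mxE inE.
have kn' : (k < n)%N := ltnW kn.
have -> : nbrs e (path_set k.+1) (Ordinal kn) = [set Ordinal kn'].
  apply/setP => i; rewrite !inE -[i == _]val_eqE /path_edge /=.
  apply/andP/eqP => [[ik]|->]; last by rewrite eqxx orbT ltnS leqnn.
  by case/orP => /eqP; [move=> E; move: ik; rewrite -E ltnNge leqnSn | case].
rewrite (green_branch (@path_edge_sym n) path_edge_bip) // ?path_set_mem //.
by rewrite IH.
Qed.

Lemma path_green k (kn : (k < n)%N) y : 0 < y ->
  green (adj (path_set k.+1)) y (ind [set Ordinal kn]) = pfun k.+1 y.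
Proof.
move=> y0; rewrite (green_branch (@path_edge_sym n) path_edge_bip) ?path_set_mem //.
  by rewrite path_branch.
exact: ltW.
Qed.

Lemma path_fdet k y : (k <= n)%N -> 0 < y ->
  fdet e (path_set k) y = \prod_(j < k) (1 + y * pfun j y) ^+ 2.
Proof.
move=> + y0; elim: k => [|k IH] kn.
  rewrite big_ord0 /fdet /bmx (_ : adj _ = 0) ?mul0mx ?scaler0 ?addr0 ?det1 //.
  by apply/matrixP => i j; rewrite !mxE !inE ltn0 !andbF.
rewrite big_ord_recr /= (fdet_branch (@path_edge_sym n) path_edge_bip (ltW y0)
  (path_set_mem kn)).
by rewrite path_branch // path_setD1 IH // ltnW.
Qed.

Lemma path_plog k y : (k <= n)%N -> 0 < y ->
  2^-1 * ln (fdet e (path_set k) y) = plog k y.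
Proof.
move=> kn y0; rewrite path_fdet // /plog.
have pos (j : nat) : 0 < 1 + y * pfun j y by rewrite onepM_gt0 // pfun_ge0.
elim: k {kn} => [|k IH]; first by rewrite !big_ord0 ln1 mulr0.
rewrite !big_ord_recr /= -IH lnM ?posrE.
- by rewrite (lnXn 2 (pos k)) mulrDr -[ln _ *+ 2]mulr_natl mulrA mulVf ?mul1r.
- by rewrite prodr_gt0 // => j _; rewrite exprn_gt0.
- by rewrite exprn_gt0.
Qed.

Lemma path_moment k (kn : (k < n)%N) (j : nat) :
  moment (adj (path_set k.+1)) (ind [set Ordinal kn]) j = pcoef R k.+1 j.
Proof.
have [_ _ pE] := pfun_enveloped R k.+1; apply: (alternating_unique _ pE).
have [_ _] := green_enveloped (adjm_sym R (@path_edge_sym n) (path_set k.+1))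
  (ind [set Ordinal kn]).
by apply: eq_alternating => y y0; rewrite path_green.
Qed.

Lemma path_row_sum S i : \sum_j adj S i j <= 2 :> R.
Proof.
apply: (@le_trans _ _ (#|[set j | e i j]|%:R : R)).
  rewrite -sum1_card natr_sum big_mkcond [leRHS]big_mkcond /=.
  apply: ler_sum => j _; rewrite !mxE inE.
  by case: (e i j) => //=; case: (_ && _); rewrite ?lexx ?ler01.
rewrite ler_nat -card_bool -(@card_in_imset _ _ (fun j => (i < j)%N)).
  exact: max_card.
move=> j j'; rewrite !inE /path_edge /= => ij ij' ltE; apply: val_inj.
case/orP: ij => /eqP E; case/orP: ij' => /eqP E' /=.
- by rewrite -E -E'.
- by move: ltE; rewrite -E ltnSn -E' => /esym; rewrite ltnNge leqnSn.
- by move: ltE; rewrite -E' ltnSn -E ltnNge leqnSn.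
- by apply: succn_inj; rewrite E E'.
Qed.

Lemma path_moment_growth S b (j : nat) :
  moment (adj S) b j.+1 <= 4 * moment (adj S) b j.
Proof.
have -> : 4 = 2 ^+ 2 :> R by ring.
apply: moment_growth => //; first exact: (adjm_sym R (@path_edge_sym n)).
- by move=> i k; rewrite mxE.
- exact: path_row_sum.
Qed.

End PathRealization.

(** * Growth of moments over several vertices *)

Section MomentGrowth.
Variables (R : realType) (n : nat) (e : rel 'I_n).
Hypothesis e_sym : symmetric e.
Variables (C : {set 'I_n}) (b : {set 'I_n}).
Hypotheses (cC : gconnected e C) (bC : b \subset C) (b2 : (1 < #|b|)%N).
Hypothesis b_indep : forall x z, x \in b -> z \in b -> ~~ e x z.
Implicit Types (x z t : 'I_n).

Local Notation A := (adjm R e C).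
Local Notation B := (indic R b).
Local Notation one := (indic R setT).

Definition natural (v : 'cV[R]_n) := forall i, exists k : nat, v i 0 = k%:R.

Lemma natural_indic a : natural (indic R a).
Proof. by move=> i; exists (i \in a); rewrite mxE. Qed.

Lemma natural_adjm v : natural v -> natural (A *m v).
Proof.
move=> nv i; have [f fE] := fin_all_exists nv.
exists (\sum_j [&& e i j, i \in C & j \in C] * f j)%N.
by rewrite mxE natr_sum; apply: eq_bigr => j _; rewrite mxE fE natrM.
Qed.

Lemma natural_dot_ge v : natural v -> dot one v <= dot v v.
Proof.
move=> nv; rewrite !dotE; apply: ler_sum => i _; have [k ->] := nv i.
by rewrite mxE inE mul1r -natrM ler_nat; case: k => // k; rewrite leq_pmulr.
Qed.

(** k ^ 2 >= 3 k - 2 for natural k, which is used on [b]; elsewhere k ^ 2 >= k. *)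
Lemma natural_dot_ge3 v : natural v ->
  dot one v + 2 * dot B v - 2 * #|b|%:R <= dot v v.
Proof.
move=> nv; have -> : #|b|%:R = dot one B :> R.
  by rewrite dot_indic setTI.
rewrite !dotE !mulr_sumr -big_split -sumrB /=.
apply: ler_sum => i _; have [k ->] := nv i; rewrite !mxE inE !mul1r.
case: (i \in b); rewrite ?mul0r ?mulr0 ?addr0 ?subr0 ?mul1r ?mulr1.
  case: k => [|[|k]]; rewrite ?mulr0n ?mulr1n; [lra | lra |].
  rewrite -!natr1; have := ler0n R k; nra.
by rewrite -natrM ler_nat; case: k => // k; rewrite leq_pmulr.
Qed.

Lemma b_nbr x : x \in b -> exists2 t, t \in C & e x t.
Proof.
move=> xb; apply: connected_neighbor => //; first exact: fintype.subsetP xb.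
exact: leq_trans b2 (subset_leq_card bC).
Qed.

Lemma adjm_one_ge x t : t \in C -> e t x -> x \in C -> 1 <= (A *m one) t 0.
Proof.
move=> tC tx xC; rewrite mxE (bigD1 x) //= !mxE tx tC xC !inE mulr1.
by rewrite lerDl sumr_ge0 // => j _; rewrite !mxE mulr_ge0.
Qed.

(** The entry is the sum of the degrees of the neighbours of x.  Were it 1, then x and
   its only neighbour t would form a component of C, so that any other element of b
   would be t, which is adjacent to x. *)
Lemma adjm_two_one_ge x : x \in b -> 2 <= (A *m (A *m one)) x 0.
Proof.
move=> xb; have xC := fintype.subsetP bC x xb.
have [t tC xt] := b_nbr xb.
have tx : e t x by rewrite e_sym.
have A0 i j : 0 <= A i j by rewrite mxE.
have D0 i : 0 <= (A *m one) i 0.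
  by rewrite mxE sumr_ge0 // => j _; rewrite mulr_ge0 // mxE.
have [[t' t'C /andP[t't xt']]|noother] :=
    pselect (exists2 t', t' \in C & (t' != t) && e x t').
  rewrite mxE (bigD1 t) //= (bigD1 t') //= [A x t]mxE [A x t']mxE xt xt' xC tC t'C.
  rewrite !mul1r addrA -[X in X <= _]addr0; apply: lerD; last first.
    by apply: sumr_ge0 => j _; rewrite mulr_ge0.
  by rewrite (_ : 2 = 1 + 1) // lerD // (@adjm_one_ge x) // e_sym.
have [[z zC /andP[zx tz]]|nofurther] :=
    pselect (exists2 z, z \in C & (z != x) && e t z).
  rewrite mxE (bigD1 t) //= [A x t]mxE xt xC tC mul1r -[X in X <= _]addr0.
  apply: lerD; last by apply: sumr_ge0 => j _; rewrite mulr_ge0.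
  rewrite mxE (bigD1 x) //= (bigD1 z) //= [A t x]mxE [A t z]mxE tx tz xC tC zC.
  rewrite !mxE !inE !mulr1 addrA -[X in X <= _]addr0 lerD //.
  by apply: sumr_ge0 => j _; rewrite !mxE mulr_ge0.
have /card_gt0P[x'] : (0 < #|b :\ x|)%N by move: b2; rewrite (cardsD1 x) xb.
rewrite !inE => /andP[x'x x'b]; have x'C := fintype.subsetP bC x' x'b.
suff : x' = x \/ x' = t.
  case=> x'E; first by rewrite x'E eqxx in x'x.
  by have := b_indep xb x'b; rewrite x'E xt.
apply: (connect_invariant (P := fun z => z = x \/ z = t) _ (cC xC x'C)); last by left.
move=> a a' /and3P[aa' aC a'C] [aE|aE]; rewrite aE in aa'.
  right; apply/eqP/negPn/negP => a't; apply: noother.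
  by exists a'; rewrite ?a't.
left; apply/eqP/negPn/negP => a'x; apply: nofurther.
by exists a'; rewrite ?a'x.
Qed.

Lemma moment1_ge : moment A B 0 <= moment A B 1.
Proof.
apply: le_trans (natural_dot_ge (natural_adjm (natural_indic b))).
rewrite /moment /= -dot_sym; last exact: adjm_sym.
rewrite !dotE; apply: ler_sum => x _; rewrite [B x 0]mxE.
case: (boolP (x \in b)) => xb; rewrite ?mulr0 // !mulr1.
have [t tC xt] := b_nbr xb.
by apply: (@adjm_one_ge t) => //; apply: fintype.subsetP xb.
Qed.

(** For G := A A B, which has natural entries, [natural_dot_ge3] bounds the sum of the
   squares of G from below by the sum of G plus 2 (moment 1) - 2 #|b|; the sum of G
   equals that of A A 1 over b, which is at least 2 #|b| by [adjm_two_one_ge]. *)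
Lemma moment2_ge : 2 * moment A B 1 <= moment A B 2.
Proof.
have As : A^T = A by exact: adjm_sym.
apply: le_trans (natural_dot_ge3 (natural_adjm (natural_adjm (natural_indic b)))).
rewrite -(dot_sym As B) -/(moment A B 1) -!(dot_sym As) -addrA addrCA lerDl subr_ge0.
have -> : #|b|%:R = dot one B :> R by rewrite dot_indic setTI.
rewrite !dotE mulr_sumr; apply: ler_sum => x _.
rewrite [one x 0]mxE inE mul1r [B x 0]mxE.
by case: (boolP (x \in b)) => xb; rewrite ?mulr0 // !mulr1 adjm_two_one_ge.
Qed.

(** Log-convexity makes the ratio of consecutive moments nondecreasing. *)
Lemma momentS_ge k : (0 < k)%N -> 2 * moment A B k <= moment A B k.+1.
Proof.
have As : A^T = A by exact: adjm_sym.
case: k => // k _; elim: k => [|k IH]; first exact: moment2_ge.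
have := moment_log_convex As B k.+1; have := moment_ge0 A B k.+1.
have := moment_ge0 A B k.+2; have := moment_ge0 A B k.+3.
move: (moment A B k.+1) (moment A B k.+2) (moment A B k.+3) IH => m m' m''.
rewrite [0 <= m]le_eqVlt => IH m''0 m'0 /predU1P[<-|m0].
  rewrite mul0r => H; have -> : m' = 0.
    by apply/eqP; rewrite -[_ == 0](@expf_eq0 _ _ 2) eq_le H sqr_ge0.
  by rewrite mulr0.
move=> H; rewrite -(ler_pM2l m0); nra.
Qed.

End MomentGrowth.

(** * Components attached along several edges *)

Section GreenTails.
Variables (R : realType) (n : nat) (A : 'M[R]_n) (b : 'cV[R]_n).
Hypothesis Asym : A^T = A.
Implicit Types (y r : R).

(** This bound and the next one share the factor r^-1 + y, so that together they
   compare the expansion errors of two Green functions. *)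
Lemma green_tail_ge k r y : 0 < y -> 0 < r ->
  r * moment A b k <= moment A b k.+1 ->
  moment A b k.+1 <= green A y (iter k.+2 (mulmx A) b) * (r^-1 + y).
Proof.
move=> y0 r0 rm; have := green_lower Asym b k (ltW y0).
have m0 := moment_ge0 A b k; have := moment_ge0 A b k.+1.
have := green_ge0 Asym (iter k.+2 (mulmx A) b) (ltW y0).
have : moment A b k <= r^-1 * moment A b k.+1 by rewrite ler_pdivlMl.
have : 0 < r^-1 by rewrite invr_gt0.
move: (green _ _ _) (moment A b k) (moment A b k.+1) (r^-1) => g m m' s.
move=> s0 mm g0; rewrite [0 <= m']le_eqVlt => /predU1P[<- _|m'0 H].
  by rewrite mulr_ge0 // ltW // addr_gt0.
rewrite -(ler_pM2l m'0) -expr2; apply: le_trans H _.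
by rewrite mulrCA ler_wpM2l // mulrDr [m' * s]mulrC [m' * y]mulrC lerD2r.
Qed.

Lemma green_tail_le k r y : 0 < y -> 0 < r ->
  moment A b k.+2 <= 2 * r * moment A b k.+1 ->
  green A y (iter k.+2 (mulmx A) b) * (r^-1 + y) <= 2 * moment A b k.+1.
Proof.
move=> y0 r0 rm; have := green_upper Asym b k.+1 y0.
have := moment_ge0 A b k.+1; have := moment_ge0 A b k.+2.
have := green_ge0 Asym (iter k.+2 (mulmx A) b) (ltW y0).
move=> g0 m'0; rewrite [0 <= moment A b k.+1]le_eqVlt => /predU1P[/esym mE _|].
  have -> : green A y (iter k.+2 (mulmx A) b) = 0.
    by rewrite iterS (dot_eq0 mE) mulmx0 /green dot0l.
  by rewrite mE mul0r mulr0.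
move: (green _ _ _) (moment A b k.+1) (moment A b k.+2) g0 m'0 rm => g m m' g0 m'0 rm m0 H.
have ri : r * r^-1 = 1 by rewrite mulfV // gt_eqF.
have s0 : 0 < r^-1 by rewrite invr_gt0.
move: (r^-1) ri s0 => s ri s0.
have pos : 0 < m + y * m' by rewrite ltr_pwDl // mulr_ge0 // ltW.
rewrite -(ler_pM2r pos) mulrAC.
apply: le_trans (ler_wpM2r _ H) _; first by rewrite ltW // addr_gt0.
have -> : m * m' * (s + y) = m * (m' * (s + y)) by ring.
have -> : 2 * m * (m + y * m') = m * (2 * (m + y * m')) by ring.
rewrite ler_pM2l //.
have : s * m' <= 2 * m.
  have -> : 2 * m = s * (2 * r * m).
    have -> : s * (2 * r * m) = r * s * (2 * m) by ring.
    by rewrite ri mul1r.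
  by rewrite ler_pM2l.
have := mulr_ge0 (ltW y0) m'0; nra.
Qed.

End GreenTails.

Section CycleCase.
Variables (R : realType) (n : nat) (e : rel 'I_n) (side : 'I_n -> bool).
Hypothesis e_sym : symmetric e.
Hypothesis e_bip : forall x y, e x y -> side x != side y.
Variables (C : {set 'I_n}) (b : {set 'I_n}).
Hypotheses (cC : gconnected e C) (bC : b \subset C) (b2 : (1 < #|b|)%N).
Hypothesis b_indep : forall x z, x \in b -> z \in b -> ~~ e x z.
Implicit Types (x z t : 'I_n) (y : R).

Local Notation A := (adjm R e C).
Local Notation B := (indic R b).
Local Notation c := #|C|.

(** Two of the attaching vertices each contribute as many closed walks as the end of
   a path, by [pcoef_le_moment]. *)
Lemma attach_moment_ge2 k : 2 * pcoef R c k <= moment A B k.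
Proof.
have /card_gt1P[x [z [xb zb xz]]] := b2.
have w v : v \in b -> pcoef R c k <= moment A (indic R [set v]) k.
  by move=> vb; apply: (pcoef_le_moment R e_sym e_bip _ cC); apply: (fintype.subsetP bC).
apply: le_trans (moment_indic_ge2 R e C k xb zb xz).
by have := w x xb; have := w z zb; lra.
Qed.

Lemma attach_moment_ge k : pcoef R c k <= moment A B k.
Proof.
apply: le_trans (attach_moment_ge2 k).
by have := pcoef_ge0 R c k; lra.
Qed.

Lemma pcoef2_le m : pcoef R m 2 <= 2 * pcoef R m 1.
Proof.
case: m => [|[|m]]; rewrite /= ?mulr0 //.
  by rewrite !geomS /conv !big_ord_recr !big_ord0 /= !mul0r !addr0 mulr0.
rewrite !geomS /conv !big_ord_recr !big_ord0 /= !add0r geomS /conv.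
rewrite big_ord_recr big_ord0 /= !add0r !geom0 !mulr1 !mul1r.
have : pcoef R m 0 <= 1 by case: m => [|m]; rewrite /= ?geom0 ?ler01.
rewrite geomS /conv big_ord_recr big_ord0 /= add0r geom0 mulr1; lra.
Qed.

(** The errors of order k + 1 are y ^ (k + 2) times Green functions of A ^ (k + 2) b.
   With r the growth rate of the moments of b at order k (1 for k = 0, and 2 after
   that), [green_tail_ge] and [green_tail_le] separate the two sides by twice the
   moment of the path. *)
Lemma attach_alternating : alternating 1
  (fun y => green A y B - pfun c y) (fun k => moment A B k - pcoef R c k).
Proof.
have [m cE] : exists m, c = m.+1.
  by exists c.-1; rewrite prednK // (leq_trans _ (subset_leq_card bC)) // ltnW.
(* the path on #|C| vertices, with its last vertex as end *)
pose P := adjm R (@path_edge m.+1) (path_set m.+1 m.+1).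
pose d := indic R [set Ordinal (ltnSn m)].
have Ps : P^T = P by apply: adjm_sym; apply: path_edge_sym.
have As : A^T = A by exact: adjm_sym.
have dE k : moment P d k = pcoef R c k by rewrite path_moment cE.
move=> [//|k] y _ y0; have y0' := ltW y0.
have -> : pfun c y = green P y d by rewrite path_green // cE.
have -> : alt_sum (fun j => moment A B j - pcoef R c j) k.+1 y =
    alt_sum (moment A B) k.+1 y - alt_sum (moment P d) k.+1 y.
  by rewrite -alt_sumB; apply: eq_bigr => j _; rewrite dE.
have -> : green A y B - green P y d -
    (alt_sum (moment A B) k.+1 y - alt_sum (moment P d) k.+1 y) =
    (green A y B - alt_sum (moment A B) k.+1 y) -
    (green P y d - alt_sum (moment P d) k.+1 y) by ring.
rewrite !green_remainder // -mulrBr mulrA -exprMn mulN1r opprK.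
apply: mulr_ge0; first exact: exprn_ge0.
pose r : R := if k is 0 then 1 else 2.
have r0 : 0 < r by rewrite /r; case: (k).
have rA : r * moment A B k <= moment A B k.+1.
  by rewrite /r; case: (k) => [|j]; [rewrite mul1r moment1_ge | apply: momentS_ge].
have rP : moment P d k.+2 <= 2 * r * moment P d k.+1.
  rewrite /r; case: (k) => [|j]; first by rewrite mulr1 !dE pcoef2_le.
  by rewrite (_ : 2 * 2 = 4) ?path_moment_growth //; ring.
have rp : 0 < r^-1 + y by rewrite addr_gt0 ?invr_gt0.
rewrite subr_ge0 -(ler_pM2r rp).
apply: le_trans (green_tail_le Ps y0 r0 rP) _.
apply: le_trans (green_tail_ge As y0 r0 rA).
by rewrite dE attach_moment_ge2.
Qed.

(** [ln_ratio_alternating] turns [attach_alternating] into the orders from 2 on.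
   As exp x >= 1 + x, order 1 is implied by
   (1 + (#|b| - 1) y) (1 + y s p) >= 1 + y s g, with p and g the two Green functions;
   this follows from 2 <= #|b|, g <= #|b|, s <= 1 and 1 <= (1 + y) p. *)
Lemma cycle_alternating s sc : enveloped s sc -> sc 0 = 1 -> exists d,
  alternating 1 (fun y =>
    ln (1 + y * (s y * pfun c y)) - ln (1 + y * (s y * green A y B))) d.
Proof.
move=> se sc0; have [sc_ge0 s0 sa] := se.
have m0 : (0 < c)%N by rewrite (leq_trans _ (subset_leq_card bC)) // ltnW.
have pe := envelopedM (pfun_enveloped R c) se.
have As : A^T = A by exact: adjm_sym.
have ge := envelopedM (green_enveloped As B) se.
have dconv k : conv (moment A B) sc k - conv (pcoef R c) sc k =
    conv (fun k => moment A B k - pcoef R c k) sc k.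
  by rewrite /conv -sumrB; apply: eq_bigr => i _; rewrite mulrBl.
have diff_ge0 k : 0 <= moment A B k - pcoef R c k by rewrite subr_ge0 attach_moment_ge.
have [|| d [d0 d1 da]] := ln_ratio_alternating (i0 := 1) pe ge.
- by move=> k; rewrite -subr_ge0 dconv conv_ge0.
- have := alternatingM diff_ge0 attach_alternating se => H i y ii y0.
  have := H i y ii y0; congr (0 <= _ * (_ - _)); first by rewrite mulrBl.
  by apply: eq_bigr => k _; rewrite dconv.
exists d; move=> [//|[|i]] y _ y0; last first.
  by have := da i.+2 y isT y0; rewrite ![s y * _]mulrC.
have y0' := ltW y0.
have d1E : d 1 = #|b|%:R - 1.
  rewrite d1 dconv /conv big_ord1 /= sc0 mulr1 /moment /= dot_indic setIid.
  by case: (c) m0 => //= j _; rewrite geom0.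
rewrite /alt_sum !big_ord_recr big_ord0 /= add0r d0 mul0r add0r expr1 d1E.
rewrite exprS expr1 mulrNN mulr1 mul1r.
have g0 := green_ge0 As B y0'; have p0 := pfun_ge0 c y0; have sy0 := s0 y y0.
have sy1 : s y <= 1.
  have := sa 0 y isT y0; rewrite alt_sum0 sc0 expr1 mulN1r opprB subr_ge0 //.
have gb : green A y B <= #|b|%:R.
  rewrite green_rec // dot_indic setIid lerBlDr lerDl mulr_ge0 //.
  exact: green_ge0.
have p1 : 1 <= (1 + y) * pfun c y.
  case: (c) m0 => //= j _; have pj := pfun_ge0 j y0.
  rewrite ler_pdivlMr ?onepM_gt0 // mul1r lerD2l ler_piMr //.
  case: (j) => [|l] /=; first exact: ler01.
  by rewrite invf_le1 ?onepM_gt0 ?pfun_ge0 // lerDl mulr_ge0 // pfun_ge0.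
have b2' : 2 <= #|b|%:R :> R by rewrite ler_nat.
move: (pfun c y) (green A y B) (s y) (#|b|%:R) g0 p0 sy0 sy1 gb p1 b2' => p g q D.
move=> g0 p0 q0 q1 gD p1 D2.
(* here q stands for the weight s y, and D for the number of attaching vertices *)
have P1 : 0 < 1 + y * (q * p) by rewrite onepM_gt0 // mulr_ge0.
have P2 : 0 < 1 + y * (q * g) by rewrite onepM_gt0 // mulr_ge0.
suff : ln (1 + y * (q * g)) <= y * (D - 1) + ln (1 + y * (q * p)) by lra.
rewrite -[y * (D - 1)]expRK -lnM ?posrE ?expR_gt0 //.
rewrite ler_ln ?posrE ?mulr_gt0 ?expR_gt0 //.
apply: le_trans (ler_wpM2r (ltW P1) (expR_ge1Dx _)).
have H1 : y * (q * g) <= y * (q * D) by rewrite ler_wpM2l // ler_wpM2l.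
apply: le_trans (_ : 1 + y * (q * D) <= _); first by rewrite lerD2l.
have Y1 : 0 < 1 + y by lra.
rewrite -(ler_pM2l Y1).
have E1 : q * y <= q * y * ((1 + y) * p) by rewrite ler_peMr ?mulr_ge0.
have E2 : 0 <= 1 + y * (D - 1) by rewrite addr_ge0 // mulr_ge0 //; lra.
have := ler_wpM2l E2 E1.
have E3 : 0 <= (1 - q) * (D - 1 + y) by rewrite mulr_ge0; lra.
have := mulr_ge0 y0' E3; have := mulr_ge0 (mulr_ge0 y0' y0') (_ : 0 <= D - 2).
rewrite subr_ge0 => /(_ D2); nra.
Qed.

End CycleCase.

(** * Induction on the graph *)

Section Comparison.
Variables (R : realType) (n : nat) (e : rel 'I_n) (side : 'I_n -> bool).
Hypothesis e_sym : symmetric e.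
Hypothesis e_bip : forall x y, e x y -> side x != side y.
Implicit Types (S C b : {set 'I_n}) (u v x : 'I_n) (y : R) (s : R -> R).

Local Notation adj := (adjm R e).
Local Notation ind := (indic R).

Lemma fdet_gt0 S y : 0 <= y -> 0 < fdet e S y.
Proof.
move=> y0; move: {2}#|S| (erefl #|S|) => N; elim: N S => [|N IH] S.
  move/eqP; rewrite cards_eq0 => /eqP ->.
  rewrite /fdet /bmx (_ : adj _ = 0) ?mul0mx ?scaler0 ?addr0 ?det1 //.
  by apply/matrixP => i j; rewrite !mxE !inE !andbF.
move=> SN; have /card_gt0P[u uS] : (0 < #|S|)%N by rewrite SN.
rewrite (fdet_branch e_sym e_bip y0 uS) mulr_gt0 ?exprn_gt0 ?IH //.
  by move: SN; rewrite (cardsD1 u) uS => -[].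
by rewrite ltr_pwDl // mulr_ge0 // branch_ge0.
Qed.

(** Half the logarithm of det (1 + y A ^ 2), up to a summand independent of S, for the
   graph obtained by attaching to the root u further branches of total self-energy
   s y. *)
Definition rooted S u s y : R :=
  2^-1 * ln (fdet e S y) + ln (1 + y * (s y * green (adj S) y (ind [set u]))).

Lemma rootedE S u s y : 0 < y -> 0 <= s y -> u \in S ->
  rooted S u s y = 2^-1 * ln (fdet e (S :\ u) y) + ln (1 + y * (s y + branch e S u y)).
Proof.
move=> y0 s0 uS; have y0' := ltW y0.
have g0 : 0 <= branch e S u y by exact: branch_ge0.
have p1 : 0 < 1 + y * branch e S u y by exact: onepM_gt0.
rewrite /rooted (fdet_branch e_sym e_bip y0' uS) (green_branch e_sym e_bip y0' uS).
rewrite lnM ?posrE ?fdet_gt0 ?exprn_gt0 // (lnXn 2 p1).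
have half (p q : R) : 2^-1 * (p + q *+ 2) = 2^-1 * p + q by field.
by rewrite half -addrA [s y * _]mulrC ln_splitD.
Qed.

(** A component C that is detached from the root acts on the rest as the weight given
   by its Green function at the neighbours of the root. *)
Lemma rooted_peel S C u s y : 0 < y -> 0 <= s y -> u \in S ->
  C \subset S :\ u ->
  (forall x z, x \in C -> z \in S :\: C :\ u -> ~~ e x z) ->
  rooted S u s y = 2^-1 * ln (fdet e C y) +
    rooted (S :\: C) u (fun y => s y + green (adj C) y (ind (nbrs e C u))) y.
Proof.
move=> y0 s0 uS CS noe; have y0' := ltW y0.
have g0 : 0 <= green (adj C) y (ind (nbrs e C u)) by rewrite green_ge0 ?adjm_sym.
rewrite !rootedE ?addr_ge0 ?(peel_mem uS CS) //.
rewrite (peel_fdet e_sym CS noe) lnM ?posrE ?fdet_gt0 // mulrDr -addrA.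
by rewrite (peel_branch e_sym CS noe) //= !addrA.
Qed.

(** The arbitrary weight at the root is what makes the induction work.  Peel a
   component C off at u.  First the rest is replaced by a path, by induction with
   the Green function g of C added to the weight.  Seen from C, the root with this
   path of a further vertices is a weight [s2]; then C is replaced by a path, by
   induction when u has a single neighbour in C, and otherwise by induction with weight 0
   for the determinant and by [cycle_alternating] for the factor of g.  The two paths,
   of a and #|C| vertices and both attached to u, are combined by
   [merge_alternating]. *)
Lemma path_dominates S u s sc : gconnected e S -> u \in S -> enveloped s sc ->
  exists d, alternating 1 (fun y =>
    plog #|S| y + ln (1 + y * (s y * pfun #|S| y)) - rooted S u s y) d.
Proof.
move: {2}#|S|.+1 (ltnSn #|S|) => N; elim: N S u s sc => // N IH S u s sc SN cS uS se.
have irr : irreflexive e by move=> x; apply: (e_irr e_bip).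
have [sc0 s0 sa] := se.
have [S1|S1] := leqP #|S| 1.
  have SE : S = [set u].
    by apply/esym/eqP; rewrite eqEcard sub1set uS cards1.
  exists (fun=> 0) => i y _ y0; rewrite SE cards1 rootedE ?inE ?s0 //.
  have -> : [set u] :\ u = finset.set0 :> {set 'I_n} by rewrite setDv.
  have A0 : adj finset.set0 = 0 by apply/matrixP => i' j; rewrite !mxE !inE !andbF.
  have -> : branch e [set u] u y = 0.
    rewrite /branch setDv (_ : nbrs e finset.set0 u = finset.set0); last first.
      by apply/setP => x; rewrite !inE.
    rewrite /green (_ : ind finset.set0 = 0) ?dot0l //.
    by apply/matrixP => i' j; rewrite !mxE inE.
  rewrite /fdet /bmx A0 mul0mx scaler0 addr0 det1 ln1 mulr0 add0r addr0.
  rewrite /plog big_ord1 /= !mulr0 !addr0 ln1 invr1 mulr1 add0r subrr.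
  by rewrite /alt_sum big1 ?subrr ?mulr0 // => k _; rewrite mul0r.
have [C [CS cC [v vC uv] cS' noe]] := peel_component e_sym irr cS uS S1.
have cardE := peel_card uS CS; set a := #|S :\: C :\ u| in cardE.
have uS' := peel_mem uS CS.
have aE : #|S :\: C| = a.+1 by rewrite (cardsD1 u) uS' add1n.
have C0 : (0 < #|C|)%N by apply/card_gt0P; exists v.
have CN : (#|C| < N)%N by move: SN; rewrite cardE ltnS; apply/leq_ltn_trans/leq_addl.
set b := nbrs e C u; pose g y := green (adj C) y (ind b).
have vb : v \in b by rewrite inE vC.
have bC : b \subset C by apply/fintype.subsetP => x; rewrite inE => /andP[].
have gE : enveloped g (moment (adj C) (ind b)).
  by apply: green_enveloped; apply: adjm_sym.
have [_ g0 _] := gE.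
have pa := pfun_enveloped R a; have [_ pa0 _] := pa.
(* the root with everything but the detached component *)
have [d1 D1] : exists d, alternating 1 (fun y =>
    plog a.+1 y + ln (1 + y * ((s y + g y) * pfun a.+1 y)) -
    rooted (S :\: C) u (fun y => s y + g y) y) d.
  rewrite -aE; apply: IH (envelopedD se gE) => //.
  move: SN; rewrite cardE aE ltnS; apply: leq_ltn_trans.
  by rewrite -addn1 leq_add2l.
(* the detached component, weighted by the path that replaced the rest *)
pose s2 y := (1 + y * (s y + pfun a y))^-1.
have s2E : enveloped s2 (geom (fun k => sc k + pcoef R a k)).
  by apply: enveloped_geom; apply: envelopedD.
have [_ s20 _] := s2E.
have [d2 D2] : exists d, alternating 1 (fun y =>
    plog #|C| y + ln (1 + y * (s2 y * pfun #|C| y)) -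
    (2^-1 * ln (fdet e C y) + ln (1 + y * (s2 y * g y)))) d.
  have [b1|b2] := leqP #|b| 1.
    have bE : b = [set v] by apply/esym/eqP; rewrite eqEcard sub1set vb cards1.
    by rewrite /g bE; apply: IH s2E.
  have [dz Dz] := IH C v _ _ CN cC vC (enveloped0 R).
  have b_indep x z : x \in b -> z \in b -> ~~ e x z.
    move=> xb zb; apply/negP => /e_bip.
    by rewrite (nbrs_side e_bip xb) (nbrs_side e_bip zb) eqxx.
  have [dc Dc] := cycle_alternating e_sym e_bip cC bC b2 b_indep s2E (geom0 _).
  exists (fun k => dz k + dc k).
  apply: eq_alternating (alternatingD Dz Dc) => y y0.
  by rewrite /rooted !mul0r !mulr0 !addr0 ln1 !addr0 opprD addrACA.
have [d3 D3] := merge_alternating a #|C| se.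
exists (fun k => d1 k + d2 k + d3 k).
apply: eq_alternating (alternatingD (alternatingD D1 D2) D3) => y y0.
have [s0y pay g0y] := And3 (s0 y y0) (pa0 y y0) (g0 y y0).
have pcy := pfun_ge0 #|C| y0; have pacy := pfun_ge0 (a + #|C|) y0.
rewrite (rooted_peel (S := S) y0 s0y uS CS noe) cardE !plogS -/b -/(g y).
have split t k : 0 <= t -> ln (1 + y * pfun k y) + ln (1 + y * (t * pfun k.+1 y)) =
    ln (1 + y * (t + pfun k y)).
  by move=> t0; rewrite ln_splitD ?pfun_ge0 // /= [t * _]mulrC.
have E1 := split (s y + g y) a (addr_ge0 s0y g0y).
have E2 := split (s y) (a + #|C|)%N s0y.
have E3 : ln (1 + y * ((s y + g y) + pfun a y)) =
    ln (1 + y * (s y + pfun a y)) + ln (1 + y * (s2 y * g y)).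
  by rewrite -ln_splitD ?addr_ge0 //; congr (ln (1 + y * _)); ring.
have E4 : ln (1 + y * (s y + (pfun a y + pfun #|C| y))) =
    ln (1 + y * (s y + pfun a y)) + ln (1 + y * (s2 y * pfun #|C| y)).
  by rewrite -ln_splitD ?addr_ge0 //; congr (ln (1 + y * _)); ring.
rewrite E4 -E2.
move: E1; rewrite E3 => E1.
rewrite -[plog a y + _ + _]addrA E1; ring.
Qed.

End Comparison.

(** * Spectra *)

Lemma prodr_scale (K : comNzRingType) (I : Type) (s : seq I) (c : K) (F : I -> K) :
  c ^+ size s * \prod_(x <- s) F x = \prod_(x <- s) (c * F x).
Proof.
elim: s => [|x s IH]; first by rewrite !big_nil mulr1.
by rewrite !big_cons exprS -IH; ring.
Qed.

Section Spectrum.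
Variables (R : realType) (n : nat).
Implicit Types (A : 'M[R]_n) (y : R).

Lemma det_one_add_scale (F : fieldType) (A : 'M[F]_n) (s : seq F) (c : F) :
  size s = n -> char_poly A = \prod_(x <- s) ('X - x%:P) ->
  \det (1%:M + c *: A) = \prod_(x <- s) (1 + c * x).
Proof.
move=> sn sE; have [->|c0] := eqVneq c 0.
  rewrite scale0r addr0 det1 big1_seq // => x _; by rewrite mul0r addr0.
have detE t : \det (t%:M - A) = \prod_(x <- s) (t - x).
  have := congr1 (horner^~ t) sE; rewrite horner_prod.
  under eq_bigr do rewrite hornerXsubC.
  move=> <-; rewrite /char_poly -[_.[t]]/(horner_eval t _) -det_map_mx.
  congr (\det _); apply/matrixP => i j; rewrite !mxE rmorphB rmorphMn /=.
  by rewrite /horner_eval hornerX hornerC.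
have -> : 1%:M + c *: A = (- c) *: ((- c^-1)%:M - A).
  rewrite scalerBr scale_scalar_mx mulrNN mulfV // scaleNr opprK //.
rewrite detZ detE -{1}sn prodr_scale; apply: eq_bigr => x _ /=.
by rewrite mulrBr mulrNN mulfV // mulNr opprK.
Qed.

Lemma size_eigenvalues A : A^T = A -> size (eigenvalues A) = n.
Proof.
move=> As; have := congr1 (fun q : {poly R} => size q) (char_poly_eigenvalues As).
by rewrite size_char_poly size_prod_XsubC => -[].
Qed.

(** Over the complex numbers 1 + y A ^ 2 = (1 + c A) (1 - c A) for a square root c of
   - y, and the determinants of the factors are read off the characteristic
   polynomial. *)
Lemma det_bmx A y : A^T = A ->
  \det (bmx A y) = \prod_(x <- eigenvalues A) (1 + y * x ^+ 2).
Proof.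
move=> As; pose f : {rmorphism R -> R[i]} := real_complex R; apply: (fmorph_inj f).
pose c := sqrtC (f (- y)); have cc : c * c = - f y.
  by rewrite -expr2 sqrtCK rmorphN.
have sE : char_poly (map_mx f A) = \prod_(x <- map f (eigenvalues A)) ('X - x%:P).
  rewrite -map_char_poly (char_poly_eigenvalues As) rmorph_prod big_map.
  by apply: eq_bigr => x _; rewrite rmorphB /= map_polyX map_polyC.
have sn : size (map f (eigenvalues A)) = n by rewrite size_map size_eigenvalues.
have -> : f (\det (bmx A y)) =
    \det (1%:M + c *: map_mx f A) * \det (1%:M + (- c) *: map_mx f A).
  rewrite -det_map_mx -det_mulmx; congr (\det _).
  rewrite /bmx map_mxD map_mx1 map_mxZ map_mxM mulmxDl mul1mx mulmxDr mulmx1.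
  rewrite -scalemxAl -scalemxAr !scaleNr scalerN scalerA cc scaleNr opprK.
  by rewrite addrA addrNK.
rewrite !(det_one_add_scale _ sn sE) -big_split big_map rmorph_prod.
apply: eq_bigr => x _ /=; rewrite rmorphD rmorph1 rmorphM rmorphXn /=.
by rewrite mulrDl mul1r mulrDr mulr1 mulNr mulrN mulrACA cc -expr2; ring.
Qed.

Lemma char_poly_opp A (s : seq R) : size s = n ->
  char_poly A = \prod_(x <- s) ('X - x%:P) ->
  char_poly (- A) = \prod_(x <- map -%R s) ('X - x%:P).
Proof.
move=> sn sE; have : char_poly A \Po (- 'X) = (-1) ^+ n * char_poly (- A).
  rewrite /char_poly -[_ \Po _]/(comp_poly (- 'X) _) -det_map_mx -detZ.
  congr (\det _); apply/matrixP => i j; rewrite !mxE !raddfB /= raddfMn /=.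
  by rewrite comp_polyX comp_polyC mulN1r polyCN opprK opprD mulNrn.
rewrite sE rmorph_prod /= => E.
have := congr1 ( *%R ((-1) ^+ n)) E.
rewrite mulrA -exprMn mulrNN mulr1 expr1n mul1r => <-.
rewrite big_map -{1}sn prodr_scale; apply: eq_bigr => x _ /=.
by rewrite comp_polyB comp_polyX comp_polyC mulN1r opprB opprK polyCN opprK addrC.
Qed.

Lemma eigenvalues_opp A : A^T = A -> char_poly (- A) = char_poly A ->
  perm_eq (eigenvalues A) (map -%R (eigenvalues A)).
Proof.
move=> As NA; apply/allP => x _ /=; apply/eqP.
rewrite -!mu_prod_XsubC -(char_poly_eigenvalues As).
by rewrite -(char_poly_opp (size_eigenvalues As) (char_poly_eigenvalues As)) NA.
Qed.

Definition pos_squares A := [seq x ^+ 2 | x <- eigenvalues A & 0 < x].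

Lemma pos_squares_gt0 A : all (fun x => 0 < x) (pos_squares A).
Proof.
apply/allP => z /mapP[x]; rewrite mem_filter => /andP[x0 _] ->.
exact: exprn_gt0.
Qed.

(** A spectrum symmetric about 0 contributes each positive eigenvalue twice. *)
Lemma ln_det_bmx A y : 0 < y -> A^T = A -> char_poly (- A) = char_poly A ->
  2^-1 * ln (\det (bmx A y)) = \sum_(x <- pos_squares A) ln (1 + y * x).
Proof.
move=> y0 As NA; have pos x : 0 < 1 + y * x ^+ 2.
  by rewrite ltr_pwDl // mulr_ge0 ?sqr_ge0 // ltW.
rewrite det_bmx //; have -> : ln (\prod_(x <- eigenvalues A) (1 + y * x ^+ 2)) =
    \sum_(x <- eigenvalues A) ln (1 + y * x ^+ 2).
  elim: (eigenvalues A) => [|x s IH]; first by rewrite !big_nil ln1.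
  by rewrite !big_cons lnM ?posrE ?prodr_gt0 // IH.
rewrite /pos_squares big_map big_filter.
have neg : \sum_(x <- eigenvalues A | ~~ (0 < x)) ln (1 + y * x ^+ 2) =
    \sum_(x <- eigenvalues A | 0 < x) ln (1 + y * x ^+ 2).
  rewrite (perm_big _ (eigenvalues_opp As NA)) big_map big_mkcond.
  rewrite [RHS]big_mkcond; apply: eq_bigr => x _; rewrite oppr_gt0 sqrrN.
  by case: (ltgtP x 0) => //= ->; rewrite expr0n mulr0 addr0 ln1.
by rewrite (bigID (fun x => 0 < x)) /= neg; field.
Qed.

End Spectrum.

Lemma pos_energy_squares (R : realType) (p : R) (G : sgraph) :
  pos_energy p G = \sum_(x <- pos_squares (adjacency R G)) x `^ (p / 2).
Proof.
rewrite /pos_energy /pos_squares big_map big_filter.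
apply: eq_bigr => x x0; rewrite -powR_mulrn ?(ltW x0) // -powRrM.
by rewrite mulrC divfK.
Qed.

(** * Graphs on ordinals *)
Section GraphTransfer.
Variables (R : realType) (G : sgraph).

Definition ord_edge : rel 'I_#|G| := fun i j => edge (enum_val i) (enum_val j).

Lemma ord_edge_sym : symmetric ord_edge.
Proof. by move=> i j; rewrite /ord_edge edge_sym. Qed.

Lemma adjacency_adjm : adjacency R G = adjm R ord_edge setT.
Proof. by apply/matrixP => i j; rewrite !mxE !inE !andbT. Qed.

Lemma gconnected_ord : connected_graph G -> gconnected ord_edge setT.
Proof.
move=> cG i j _ _; rewrite -[j]enum_valK.
pose P x := connect (erel ord_edge setT) i (enum_rank x).
apply: (connect_invariant (P := P) _ (cG (enum_val i) (enum_val j))); rewrite /P.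
  move=> a b ab ia; apply: connect_trans ia (connect1 _).
  by rewrite /erel /= /ord_edge !enum_rankK ab !inE.
by rewrite enum_valK connect0.
Qed.

Lemma bipartite_char_poly_opp : bipartite_graph G ->
  char_poly (- adjacency R G) = char_poly (adjacency R G).
Proof.
case=> side sideP; rewrite adjacency_adjm.
have bip i j : ord_edge i j -> side (enum_val i) != side (enum_val j) by apply: sideP.
pose D := signmx R (fun i : 'I_#|G| => side (enum_val i)).
have DD : D *m D = 1%:M by apply: signmx_sqr.
have Du : D \in unitmx by have [] := mulmx1_unit DD.
rewrite -[RHS](char_poly_similar _ Du); congr char_poly.
have -> : invmx D = D by rewrite -[LHS]mulmx1 -DD mulKmx.
by rewrite (signmx_adjm R bip) mulNmx -mulmxA DD mulmx1.
Qed.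

End GraphTransfer.

Section PathSpectrum.
Variables (R : realType) (n : nat).

Local Notation m := #|path_graph n|.

Lemma adjacency_path :
  adjacency R (path_graph n) = adjm R (@path_edge m) (path_set m m).
Proof.
apply/matrixP => i j; rewrite !mxE !inE !ltn_ord !andbT /path_edge /=.
by rewrite !enum_val_ord.
Qed.

Lemma path_pos_squares y : 0 < y ->
  \sum_(x <- pos_squares (adjacency R (path_graph n))) ln (1 + y * x) = plog m y.
Proof.
move=> y0; have bip : bipartite_graph (path_graph n).
  by exists (fun i : 'I_n => odd i); apply: path_edge_bip.
rewrite -ln_det_bmx ?adjacency_sym ?bipartite_char_poly_opp //.
by rewrite adjacency_path path_plog.
Qed.

End PathSpectrum.

Theorem theorem3p2 (R : realType) (n : nat) (G : sgraph) :
  #|G| = n -> connected_graph G -> bipartite_graph G ->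
  forall p : R, 2 <= p -> pos_energy p (path_graph n) <= pos_energy p G.
Proof.
move=> Gn cG bG p p2.
have mn : #|path_graph n| = #|G| by rewrite Gn card_ord.
rewrite !pos_energy_squares.
have [G0|/card_gt0P[x _]] := posnP #|G|.
  have noev (H : sgraph) : #|H| = 0 -> pos_squares (adjacency R H) = [::].
    move=> H0; rewrite /pos_squares (size0nil (s := eigenvalues _)) //.
    by rewrite size_eigenvalues_adjacency.
  by rewrite !noev ?mn // !big_nil.
have [side sideP] := bG.
have bip i j : ord_edge i j -> side (enum_val i) != side (enum_val j) by apply: sideP.
have [d dP] := path_dominates (@ord_edge_sym G) bip (gconnected_ord cG)
  (in_setT (enum_rank x)) (enveloped0 R).
apply: (power_sum_le (d := d)); rewrite ?pos_squares_gt0 //; first lra.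
apply: eq_alternating dP => y y0.
rewrite path_pos_squares // mn -ln_det_bmx ?adjacency_sym ?bipartite_char_poly_opp //.
rewrite /rooted !mul0r !mulr0 !addr0 ln1 !addr0 cardsT card_ord.
by rewrite adjacency_adjm.
Qed.
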